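(* Let $0<s\le1$ and let $h\in\mathcal{CV}_{hpl}(s)$ with $h(z)=z+d_2z^2+d_3z^3+\cdots$. Then the second Hankel determinant $H_2(2)=d_2d_4-d_3^2$ of $h$ satisfies $$|H_2(2)|=|d_2d_4-d_3^2|\le\frac{s^2}{36}\left(1+\frac{9s^2}{8(s^2+3s+6)}\right).$$
   Context: Let $\mathbb{D}=\{z\in\mathbb{C}:|z|<1\}$, and let $\mathcal{S}$ be the class of functions $f(z)=z+\sum_{n\ge2}a_nz^n$ that are holomorphic and univalent in $\mathbb{D}$. For $0<s\le1$ put $\mathfrak{q}_s(z)=(1-z)^{-s}=e^{-s\ln(1-z)}$, $z\in\mathbb{D}$, with the branch of the logarithm such that $\mathfrak{q}_s(0)=1$. For holomorphic functions $p,F$ in $\mathbb{D}$, $p\prec F$ (subordination) means that there is a holomorphic $\omega:\mathbb{D}\to\mathbb{D}$ with $\omega(0)=0$ and $p(z)=F(\omega(z))$ for all $z\in\mathbb{D}$. The class $\mathcal{CV}_{hpl}(s)$ consists of all $f\in\mathcal{S}$ with $1+\frac{zf''(z)}{f'(z)}\prec\mathfrak{q}_s(z)$ in $\mathbb{D}$. *)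

(* Defs.v *)
From Stdlib Require Import Reals.
From Coquelicot Require Import Coquelicot.
Open Scope R_scope.

(* The unit disk.  Functions on the disk are total functions C -> C of which
   only the values at points of the disk are ever used. *)
Definition in_disk (z : C) : Prop := Cmod z < 1.

Definition holomorphic_on_disk (f : C -> C) : Prop :=
  forall z : C, in_disk z ->
    @ex_derive C_AbsRing C_NormedModule f z.

Definition univalent_on_disk (f : C -> C) : Prop :=
  forall z w : C, in_disk z -> in_disk w -> f z = f w -> z = w.

(* f(z) = z + a_2 z^2 + a_3 z^3 + ... for |z| < 1. *)
Definition normalized_expansion (f : C -> C) (a : nat -> C) : Prop :=
  a 0%nat = RtoC 0 /\ a 1%nat = RtoC 1 /\
  forall z : C, in_disk z -> @is_pseries C_AbsRing C_NormedModule a z (f z).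

Definition class_S (f : C -> C) : Prop :=
  holomorphic_on_disk f /\ univalent_on_disk f /\
  exists a : nat -> C, normalized_expansion f a.

Definition subordinate (p F : C -> C) : Prop :=
  exists omega : C -> C,
    holomorphic_on_disk omega /\
    (forall z : C, in_disk z -> in_disk (omega z)) /\
    omega (RtoC 0) = RtoC 0 /\
    (forall z : C, in_disk z -> p z = F (omega z)).

Definition Cexp (z : C) : C :=
  (exp (Re z) * cos (Im z), exp (Re z) * sin (Im z)).

(* Principal logarithm.  The formula for the argument is only meaningful on
   the half-plane Re z > 0, which contains 1 - z for every z in the disk. *)
Definition Clog (z : C) : C := (ln (Cmod z), atan (Im z / Re z)).

Definition q_hpl (s : R) (z : C) : C :=
  Cexp (- RtoC s * Clog (RtoC 1 - z))%C.

(* Division is total, but for f in class_S the derivative does not vanish on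
   the disk, f being univalent. *)
Definition convexity_quotient (f : C -> C) (z : C) : C :=
  (RtoC 1 + z * C_derive (C_derive f) z / C_derive f z)%C.

Definition CV_hpl (s : R) (f : C -> C) : Prop :=
  class_S f /\ subordinate (convexity_quotient f) (q_hpl s).

(* The determinant of the matrix with rows (a_2, a_3) and (a_3, a_4). *)
Definition hankel_2_2 (a : nat -> C) : C :=
  (a 2%nat * a 4%nat - a 3%nat ^ 2)%C.

(* Main.v *)
Require Import Defs.
From Stdlib Require Import Reals Lra Lia Psatz Classical ClassicalEpsilon.
From Coquelicot Require Import Coquelicot.
Open Scope R_scope.

(** Let [omega] be the Schwarz function of the subordination,
    [1 + z h'' / h' = (1 - omega)^(-s)].  Comparing expansions at 0 up to order
    3 expresses [d_2], [d_3], [d_4] by the first coefficients of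
    [omega = c1 z + c2 z^2 + c3 z^3 + O (z^4)] ([schwarz_coefficients]), and
    turns the Hankel determinant into [s^2 / 144] times
    [6 c1 c3 + (3 s + 2) c1^2 c2 - 4 c2^2 + (2 + 3 s - s^2) / 2 c1^4].

    The coefficients of a Schwarz function satisfy, with [D = 1 - |c1|^2],
    [|c2| <= D] and [|D c3 + conj c1 c2^2| <= D^2 - |c2|^2]
    ([schwarz_pick_coefficients]).  Eliminating [c3] and then [c2] by these
    inequalities bounds the expression above by
    [4 + 3 s u - (s^2 + 3 s + 6) / 2 u^2], where [u = |c1|^2], and the maximum
    of this quadratic polynomial is the asserted bound
    ([hankel_schwarz_bound]).

    The analytic point is that the three coefficients are only given by the
    behaviour of [omega] at 0, whereas the inequalities come from
    [|omega| < 1] on the whole disk, where [omega] is merely complex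
    differentiable.  Goursat's theorem, proved for closed real differential
    forms ([goursat_rectangle]) and applied to [omega (exp w) exp (- m w)],
    shows that the mean of [omega (z) z^(-m)] on a circle around 0 does not
    depend on the radius, and so equals the coefficient [c_m]
    ([circle_mean_coeff]).  Bessel's inequality on circles of radius [r < 1]
    then says that the lower triangular Toeplitz matrix of the numbers
    [r^k c_k] is a contraction ([toeplitz_of_bounded]), and the coefficient
    inequalities are consequences of that. *)

(** * The complex exponential *)

Lemma Cexp_0 : Cexp (RtoC 0) = RtoC 1.
Proof.
  unfold Cexp, RtoC; simpl; rewrite exp_0, cos_0, sin_0.
  apply injective_projections; simpl; ring.
Qed.

Lemma Cexp_plus (z w : C) : Cexp (z + w)%C = (Cexp z * Cexp w)%C.
Proof.
  destruct z, w; unfold Cexp; simpl; rewrite exp_plus, cos_plus, sin_plus.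
  apply injective_projections; simpl; ring.
Qed.

Lemma Cmod_Cexp (z : C) : Cmod (Cexp z) = exp (Re z).
Proof.
  unfold Cmod, Cexp; simpl.
  replace (_ + _) with (Rsqr (exp (Re z)) * (Rsqr (sin (Im z)) + Rsqr (cos (Im z))))
    by (unfold Rsqr; ring).
  rewrite sin2_cos2, Rmult_1_r, sqrt_Rsqr; auto.
  left; apply exp_pos.
Qed.

Lemma Cmod_le_components (z : C) (M : R) :
  Rabs (Re z) <= M -> Rabs (Im z) <= M -> Cmod z <= 2 * M.
Proof.
  intros H1 H2.
  eapply Rle_trans; [apply Cmod_2Rmax|].
  assert (Hm : Rmax (Rabs (fst z)) (Rabs (snd z)) <= M) by (apply Rmax_lub; auto).
  assert (0 <= Rmax (Rabs (fst z)) (Rabs (snd z)))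
    by (eapply Rle_trans; [apply Rabs_pos | apply Rmax_l]).
  assert (sqrt 2 <= 2) by (apply Rsqr_incr_0_var; [rewrite Rsqr_sqrt; unfold Rsqr; lra | lra]).
  assert (0 <= sqrt 2) by apply sqrt_pos.
  nra.
Qed.

Lemma im_le_Cmod (z : C) : Rabs (Im z) <= Cmod z.
Proof. eapply Rle_trans; [apply Rmax_r | apply Rmax_Cmod]. Qed.

(** A mean value inequality replaces the mean value theorem, which fails for
    complex-valued functions.  The hypotheses say that
    [d/dt F (t u) = u G (t u)], so that [G] is morally [F'], but only the
    derivative along the ray is asked for: it can then be computed coordinate
    by coordinate.  The factor 2 is a crude bound for the square root of 2 that
    appears when the two coordinates are estimated separately. *)
Lemma ray_mean_value (F G : C -> C) (u : C) (M : R) :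
  (forall t, 0 <= t <= 1 ->
     is_derive (fun t : R => Re (F (RtoC t * u)%C)) t (Re (u * G (RtoC t * u)))%C) ->
  (forall t, 0 <= t <= 1 ->
     is_derive (fun t : R => Im (F (RtoC t * u)%C)) t (Im (u * G (RtoC t * u)))%C) ->
  (forall t, 0 <= t <= 1 -> Cmod (G (RtoC t * u)%C) <= M) ->
  Cmod (F u - F (RtoC 0))%C <= 2 * (M * Cmod u).
Proof.
  intros HR HI HM.
  assert (E1 : (RtoC 1 * u)%C = u) by ring.
  assert (E0 : (RtoC 0 * u)%C = RtoC 0) by ring.
  assert (Hbd : forall t, 0 <= t <= 1 -> Cmod (u * G (RtoC t * u))%C <= M * Cmod u).
  { intros t Ht; rewrite Cmod_mult.
    specialize (HM t Ht); pose proof (Cmod_ge_0 u); nra. }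
  apply Cmod_le_components.
  - destruct (MVT_gen (fun t : R => Re (F (RtoC t * u)%C)) 0 1
      (fun t => Re (u * G (RtoC t * u))%C)) as [t [Ht Heq]];
      rewrite ?Rmin_left, ?Rmax_right in * by lra.
    + intros x Hx; apply HR; lra.
    + intros x Hx; apply derivable_continuous_pt.
      exists (Re (u * G (RtoC x * u))%C); apply is_derive_Reals, HR; lra.
    + cbv beta in Heq; rewrite E1, E0 in Heq.
      change (Rabs (Re (F u) - Re (F (RtoC 0))) <= M * Cmod u).
      rewrite Heq, Rminus_0_r, Rmult_1_r.
      eapply Rle_trans; [apply re_le_Cmod | auto].
  - destruct (MVT_gen (fun t : R => Im (F (RtoC t * u)%C)) 0 1
      (fun t => Im (u * G (RtoC t * u))%C)) as [t [Ht Heq]];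
      rewrite ?Rmin_left, ?Rmax_right in * by lra.
    + intros x Hx; apply HI; lra.
    + intros x Hx; apply derivable_continuous_pt.
      exists (Im (u * G (RtoC x * u))%C); apply is_derive_Reals, HI; lra.
    + cbv beta in Heq; rewrite E1, E0 in Heq.
      change (Rabs (Im (F u) - Im (F (RtoC 0))) <= M * Cmod u).
      rewrite Heq, Rminus_0_r, Rmult_1_r.
      eapply Rle_trans; [apply im_le_Cmod | auto].
Qed.

Lemma Cmod_ray_le (t : R) (u : C) :
  0 <= t <= 1 -> Cmod (RtoC t * u)%C <= Cmod u.
Proof.
  intros Ht; rewrite Cmod_mult, Cmod_R, Rabs_right by lra.
  pose proof (Cmod_ge_0 u); nra.
Qed.

Definition exp_taylor (n : nat) (u : C) : C :=
  match n with
  | 0%nat => RtoC 1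
  | 1%nat => (1 + u)%C
  | 2%nat => (1 + u + RtoC (/ 2) * (u * u))%C
  | _ => (1 + u + RtoC (/ 2) * (u * u) + RtoC (/ 6) * (u * u * u))%C
  end.

(** The remainder of order [n] is differentiated along a ray into the
    remainder of order [n - 1], so each of the next bounds follows from the
    previous one by [ray_mean_value]. *)
Lemma exp_taylor_bound_0 (u : C) :
  Cmod u <= 1 -> Cmod (Cexp u - exp_taylor 0 u)%C <= 6 * Cmod u.
Proof.
  intros Hu; simpl; rewrite <- Cexp_0.
  replace (6 * Cmod u) with (2 * (3 * Cmod u)) by ring.
  destruct u as [a b].
  apply ray_mean_value with (G := Cexp).
  - intros t _; unfold Cexp; simpl; auto_derive; auto; unfold Rminus; ring.
  - intros t _; unfold Cexp; simpl; auto_derive; auto; unfold Rminus; ring.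
  - intros t Ht; rewrite Cmod_Cexp.
    apply Rle_trans with (exp 1); [|apply exp_le_3].
    destruct (Rle_lt_or_eq_dec (Re (RtoC t * (a, b))%C) 1) as [H|H].
    + eapply Rle_trans; [apply Rle_abs|].
      eapply Rle_trans; [apply re_le_Cmod|].
      eapply Rle_trans; [apply Cmod_ray_le; auto | auto].
    + left; apply exp_increasing; auto.
    + rewrite H; lra.
Qed.

Ltac subtract_value_at_0 :=
  match goal with |- Cmod (Cexp ?u - exp_taylor ?n ?u)%C <= _ =>
    replace (Cexp u - exp_taylor n u)%C with
      ((Cexp u - exp_taylor n u) - (Cexp 0 - exp_taylor n 0))%C
      by (rewrite Cexp_0; simpl; ring)
  end.

Lemma exp_taylor_bound_1 (u : C) :
  Cmod u <= 1 -> Cmod (Cexp u - exp_taylor 1 u)%C <= 12 * Cmod u ^ 2.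
Proof.
  intros Hu; subtract_value_at_0.
  replace (12 * Cmod u ^ 2) with (2 * (6 * Cmod u * Cmod u)) by ring.
  destruct u as [a b].
  apply (ray_mean_value (fun u => Cexp u - exp_taylor 1 u)%C
           (fun u => Cexp u - exp_taylor 0 u)%C).
  - intros t _; unfold Cexp; simpl; auto_derive; auto; unfold Rminus; ring.
  - intros t _; unfold Cexp; simpl; auto_derive; auto; unfold Rminus; ring.
  - intros t Ht; pose proof (Cmod_ray_le t (a, b) Ht).
    eapply Rle_trans; [apply exp_taylor_bound_0; lra | lra].
Qed.

Lemma exp_taylor_bound_2 (u : C) :
  Cmod u <= 1 -> Cmod (Cexp u - exp_taylor 2 u)%C <= 24 * Cmod u ^ 3.
Proof.
  intros Hu; subtract_value_at_0.
  replace (24 * Cmod u ^ 3) with (2 * (12 * Cmod u ^ 2 * Cmod u)) by ring.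
  destruct u as [a b].
  apply (ray_mean_value (fun u => Cexp u - exp_taylor 2 u)%C
           (fun u => Cexp u - exp_taylor 1 u)%C).
  - intros t _; unfold Cexp; simpl; auto_derive; auto; unfold Rminus; field.
  - intros t _; unfold Cexp; simpl; auto_derive; auto; unfold Rminus; field.
  - intros t Ht; pose proof (Cmod_ray_le t (a, b) Ht).
    eapply Rle_trans; [apply exp_taylor_bound_1; lra |].
    apply Rmult_le_compat_l; [lra | apply pow_incr; split; [apply Cmod_ge_0 | auto]].
Qed.

Lemma exp_taylor_bound_3 (u : C) :
  Cmod u <= 1 -> Cmod (Cexp u - exp_taylor 3 u)%C <= 48 * Cmod u ^ 4.
Proof.
  intros Hu; subtract_value_at_0.
  replace (48 * Cmod u ^ 4) with (2 * (24 * Cmod u ^ 3 * Cmod u)) by ring.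
  destruct u as [a b].
  apply (ray_mean_value (fun u => Cexp u - exp_taylor 3 u)%C
           (fun u => Cexp u - exp_taylor 2 u)%C).
  - intros t _; unfold Cexp; simpl; auto_derive; auto; unfold Rminus; field.
  - intros t _; unfold Cexp; simpl; auto_derive; auto; unfold Rminus; field.
  - intros t Ht; pose proof (Cmod_ray_le t (a, b) Ht).
    eapply Rle_trans; [apply exp_taylor_bound_2; lra |].
    apply Rmult_le_compat_l; [lra | apply pow_incr; split; [apply Cmod_ge_0 | auto]].
Qed.

(** The disks of [C_AbsRing] are Euclidean, whereas the balls of the uniform
    space [C] are squares; this form of the derivative hides the difference. *)
Lemma is_derive_C_iff (f : C -> C) (z l : C) :
  @is_derive C_AbsRing C_NormedModule f z l <->
  forall eps : posreal, exists delta : posreal, forall w : C,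
    Cmod (w - z)%C < delta ->
    Cmod (f w - f z - (w - z) * l)%C <= eps * Cmod (w - z)%C.
Proof.
  split.
  - intros [_ H] eps.
    destruct (H z (fun P HP => HP) eps) as [d Hd].
    exists d; intros w Hw; exact (Hd w Hw).
  - intros H; split.
    + apply is_linear_scal_l.
    + intros x Hx.
      assert (E : z = x) by
        exact (is_filter_lim_locally_unique (V := AbsRing_NormedModule C_AbsRing) z x Hx).
      subst x.
      intros eps; destruct (H eps) as [d Hd].
      exists d; intros w Hw; exact (Hd w Hw).
Qed.

Lemma is_derive_Cexp (z : C) :
  @is_derive C_AbsRing C_NormedModule Cexp z (Cexp z).
Proof.
  apply is_derive_C_iff; intros eps.
  assert (He := exp_pos (Re z)).
  assert (Hd : 0 < Rmin 1 (eps / (12 * exp (Re z)))).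
  { apply Rmin_glb_lt; [lra|]. apply Rdiv_lt_0_compat; [apply cond_pos | lra]. }
  exists (mkposreal _ Hd); simpl; intros w Hw.
  replace (Cexp w - Cexp z - (w - z) * Cexp z)%C
    with (Cexp z * (Cexp (w - z) - exp_taylor 1 (w - z)))%C.
  2:{ replace w with (z + (w - z))%C at 3 by ring.
      rewrite (Cexp_plus z (w - z)); simpl; ring. }
  rewrite Cmod_mult, Cmod_Cexp.
  assert (H1 := exp_taylor_bound_1 (w - z)%C).
  assert (H2 := Rmin_l 1 (eps / (12 * exp (Re z)))).
  assert (H3 := Rmin_r 1 (eps / (12 * exp (Re z)))).
  assert (H4 : Cmod (w - z)%C * (12 * exp (Re z)) <= eps).
  { apply Rle_trans with (eps / (12 * exp (Re z)) * (12 * exp (Re z))).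
    - apply Rmult_le_compat_r; lra.
    - right; field; lra. }
  assert (H5 := Cmod_ge_0 (w - z)%C).
  specialize (H1 ltac:(lra)).
  nra.
Qed.

(** * Power series near the origin *)

Definition power_sum (a : nat -> C) (z l : C) : Prop :=
  @is_series C_AbsRing C_NormedModule (fun n => (a n * z ^ n)%C) l.

Lemma power_sum_of_pseries (a : nat -> C) (z l : C) :
  @is_pseries C_AbsRing C_NormedModule a z l -> power_sum a z l.
Proof.
  apply is_series_ext; intros n.
  assert (E : @pow_n C_Ring z n = (z ^ n)%C).
  { induction n as [|n IH]; [reflexivity|].
    simpl; rewrite IH; reflexivity. }
  change (@pow_n C_Ring z n * a n = a n * z ^ n)%C.
  rewrite E; ring.
Qed.

Definition derived_coeff (a : nat -> C) (n : nat) : C :=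
  (RtoC (INR (S n)) * a (S n))%C.

Lemma series_geometric_bound (b : nat -> C) (l : C) (M : R) :
  @is_series C_AbsRing C_NormedModule b l ->
  (forall n, Cmod (b n) <= M * (/ 2) ^ n) -> Cmod l <= 2 * M.
Proof.
  intros Hs Hb.
  assert (HM : 0 <= M).
  { specialize (Hb 0%nat); simpl in Hb; pose proof (Cmod_ge_0 (b 0%nat)); lra. }
  assert (Hp : forall n, Cmod (@sum_n C_AbelianGroup b n) <= 2 * M - M * (/ 2) ^ n).
  { induction n as [|n IH].
    - rewrite sum_O; specialize (Hb 0%nat); simpl in *; lra.
    - rewrite sum_Sn.
      eapply Rle_trans; [apply Cmod_triangle|].
      specialize (Hb (S n)); simpl in *; lra. }
  apply Rnot_lt_le; intros Hl.
  assert (He : 0 < Cmod l - 2 * M) by lra.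
  assert (Hn := proj1 (filterlim_locally_ball_norm _ _) Hs (mkposreal _ He)).
  destruct Hn as [N HN].
  specialize (HN N (le_n N)).
  unfold ball_norm in HN; simpl in HN.
  change (Cmod (@sum_n C_AbelianGroup b N - l)%C < Cmod l - 2 * M) in HN.
  specialize (Hp N).
  set (S := @sum_n C_AbelianGroup b N) in *.
  assert (H2 := pow_lt (/ 2) N ltac:(lra)).
  assert (H3 : Cmod l <= Cmod (S - l)%C + Cmod S).
  { rewrite <- (Cmod_opp (S - l)%C).
    eapply Rle_trans; [|apply Cmod_triangle].
    right; f_equal; ring. }
  nra.
Qed.

Section PowerSeries.
Variables (a : nat -> C) (K rho : R).
Hypothesis (Hrho : 0 < rho) (Ha : forall n, Cmod (a n) <= K * rho ^ n).

Lemma coeff_bound_nonneg : 0 <= K.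
Proof.
  specialize (Ha 0%nat); simpl in Ha; pose proof (Cmod_ge_0 (a 0%nat)); lra.
Qed.

Lemma power_term_bound (z : C) (n : nat) :
  Cmod (a n * z ^ n)%C <= K * (rho * Cmod z) ^ n.
Proof.
  rewrite Cmod_mult, Cmod_pow, Rpow_mult_distr, <- Rmult_assoc.
  apply Rmult_le_compat_r; [apply pow_le, Cmod_ge_0 | auto].
Qed.

Lemma power_sum_exists (z : C) :
  rho * Cmod z <= / 2 -> exists l : C, power_sum a z l.
Proof.
  intros Hz.
  apply (@ex_series_le C_AbsRing C_CompleteNormedModule
           (fun n => a n * z ^ n)%C (fun n => K * (/ 2) ^ n)).
  - intros n; change (Cmod (a n * z ^ n)%C <= K * (/ 2) ^ n).
    eapply Rle_trans; [apply power_term_bound|].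
    apply Rmult_le_compat_l; [apply coeff_bound_nonneg|].
    apply pow_incr; split; auto.
    apply Rmult_le_pos; [lra | apply Cmod_ge_0].
  - apply (ex_series_scal_l (K := R_AbsRing) K (fun n => (/ 2) ^ n)).
    exists (/ (1 - / 2)); apply is_series_geom; rewrite Rabs_right; lra.
Qed.

Lemma power_sum_taylor_2 (z l : C) :
  rho * Cmod z <= / 2 -> power_sum a z l ->
  Cmod (l - (a 0%nat + a 1%nat * z + a 2%nat * z ^ 2))%C
    <= 2 * K * rho ^ 3 * Cmod z ^ 3.
Proof.
  intros Hz Hl.
  assert (H3 : (0 < 3)%nat) by lia.
  assert (Hs : @is_series C_AbsRing C_NormedModule
    (fun k => a (3 + k)%nat * z ^ (3 + k))%C
    (l - (a 0%nat + a 1%nat * z + a 2%nat * z ^ 2))%C).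
  { apply (is_series_incr_n (fun n => a n * z ^ n)%C 3 _ H3).
    replace (plus _ _) with l; [exact Hl|].
    simpl; rewrite !sum_Sn, sum_O.
    change (l = l - (a 0%nat + a 1%nat * z + a 2%nat * (z * (z * 1)))
      + (a 0%nat * 1 + a 1%nat * (z * 1) + a 2%nat * (z * (z * 1))))%C; ring. }
  replace (2 * K * rho ^ 3 * Cmod z ^ 3) with (2 * (K * (rho * Cmod z) ^ 3)) by ring.
  apply (series_geometric_bound _ _ _ Hs).
  intros n; eapply Rle_trans; [apply power_term_bound|].
  rewrite pow_add, <- Rmult_assoc.
  assert (0 <= rho * Cmod z) by (apply Rmult_le_pos; [lra | apply Cmod_ge_0]).
  apply Rmult_le_compat_l.
  - apply Rmult_le_pos; [apply coeff_bound_nonneg | apply pow_le; auto].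
  - apply pow_incr; auto.
Qed.

Lemma derived_coeff_bound (n : nat) :
  Cmod (derived_coeff a n) <= K * rho * (2 * rho) ^ n.
Proof.
  unfold derived_coeff; rewrite Cmod_mult, Cmod_R, Rabs_right
    by (apply Rle_ge, pos_INR).
  assert (Hn : INR (S n) <= 2 ^ n).
  { clear; induction n as [|n IH]; [simpl; lra|].
    rewrite S_INR; simpl (2 ^ _).
    assert (1 <= 2 ^ n) by (apply pow_R1_Rle; lra). lra. }
  apply Rle_trans with (2 ^ n * (K * rho ^ S n)).
  - apply Rmult_le_compat; auto; [apply pos_INR | apply Cmod_ge_0].
  - right; rewrite Rpow_mult_distr; simpl; ring.
Qed.

(** The general term, up to the factor [a (S n)], of
    [f w - f z - (w - z) * f' z]. *)
Definition second_order_difference (z w : C) (n : nat) : C :=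
  (w ^ S n - z ^ S n - RtoC (INR (S n)) * z ^ n * (w - z))%C.

(** Multiplying by [r] avoids the exponent [n - 1].  The induction rests on
    [Q (n+1) = w Q n + (n+1) z^n (w - z)^2]. *)
Lemma second_order_difference_bound (z w : C) (r : R) (n : nat) :
  Cmod z <= r -> Cmod w <= r ->
  r * Cmod (second_order_difference z w n) <= Cmod (w - z)%C ^ 2 * (4 * r) ^ n.
Proof.
  intros Hz Hw.
  assert (Hr : 0 <= r) by (eapply Rle_trans; [apply Cmod_ge_0 | exact Hz]).
  induction n as [|n IH].
  - unfold second_order_difference.
    replace (w ^ 1 - z ^ 1 - RtoC (INR 1) * z ^ 0 * (w - z))%C with (RtoC 0)
      by (simpl; ring).
    rewrite Cmod_0; simpl; pose proof (Cmod_ge_0 (w - z)%C); nra.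
  - replace (second_order_difference z w (S n)) with
      (w * second_order_difference z w n
       + RtoC (INR (S n)) * z ^ n * ((w - z) * (w - z)))%C.
    2:{ unfold second_order_difference.
        rewrite (S_INR (S n)), RtoC_plus.
        set (N := RtoC (INR (S n))); simpl; ring. }
    assert (Hn : INR (S n) <= 4 ^ n * 3).
    { clear; induction n as [|n IH]; [simpl; lra|].
      rewrite S_INR; simpl (4 ^ _).
      assert (1 <= 4 ^ n) by (apply pow_R1_Rle; lra). lra. }
    set (D := Cmod (w - z)%C) in *.
    assert (HD : 0 <= D) by apply Cmod_ge_0.
    assert (HB : Cmod (RtoC (INR (S n)) * z ^ n * ((w - z) * (w - z)))%C
                 <= 3 * 4 ^ n * r ^ n * D ^ 2).
    { rewrite !Cmod_mult, Cmod_R, Cmod_pow, Rabs_right by (apply Rle_ge, pos_INR).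
      fold D; replace (D * D) with (D ^ 2) by ring.
      apply Rmult_le_compat_r; [apply pow2_ge_0|].
      apply Rmult_le_compat; [apply pos_INR | apply pow_le, Cmod_ge_0 | lra |].
      apply pow_incr; split; [apply Cmod_ge_0 | auto]. }
    assert (HA : r * Cmod (w * second_order_difference z w n)%C
                 <= r * (D ^ 2 * (4 * r) ^ n)).
    { rewrite Cmod_mult.
      set (q := Cmod (second_order_difference z w n)) in *.
      assert (0 <= q) by apply Cmod_ge_0.
      apply Rle_trans with (r * (r * q)).
      - apply Rmult_le_compat_l; auto; apply Rmult_le_compat_r; auto.
      - apply Rmult_le_compat_l; auto. }
    apply Rle_trans with (r * (D ^ 2 * (4 * r) ^ n) + r * (3 * 4 ^ n * r ^ n * D ^ 2)).
    + eapply Rle_trans; [apply Rmult_le_compat_l; [auto | apply Cmod_triangle]|].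
      rewrite Rmult_plus_distr_l; apply Rplus_le_compat; auto.
      apply Rmult_le_compat_l; auto.
    + right; simpl ((4 * r) ^ S n); rewrite !Rpow_mult_distr; ring.
Qed.

(** Term-by-term differentiation.  It is only needed near 0, so the radius
    [1 / (8 rho)] is chosen small enough to turn every majorant into the
    geometric series of ratio 1/2; the remainder of the first-order expansion
    is then [O (|w - z|^2)] with an explicit constant. *)
Lemma is_derive_power_sum (f : C -> C) (z l : C) (r : R) :
  r = / (8 * rho) ->
  (forall w, Cmod w < r -> power_sum a w (f w)) ->
  Cmod z < r -> power_sum (derived_coeff a) z l ->
  @is_derive C_AbsRing C_NormedModule f z l.
Proof.
  intros Hr Hf Hz Hl.
  assert (HK := coeff_bound_nonneg).
  assert (Hr0 : 0 < r) by (rewrite Hr; apply Rinv_0_lt_compat; lra).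
  assert (Hest : forall w, Cmod w < r ->
    Cmod (f w - f z - (w - z) * l)%C <= 16 * K * rho ^ 2 * Cmod (w - z)%C ^ 2).
  { intros w Hw.
    assert (Hsw : forall v, Cmod v < r -> @is_series C_AbsRing C_NormedModule
              (fun n => a (S n) * v ^ S n)%C (f v - a 0%nat)%C).
    { intros v Hv; apply (is_series_incr_1 (fun n => a n * v ^ n)%C).
      replace (plus _ _) with (f v); [apply Hf, Hv|].
      change (f v = f v - a 0%nat + a 0%nat * 1)%C; ring. }
    assert (Hs := is_series_minus _ _ _ _
       (is_series_minus _ _ _ _ (Hsw w Hw) (Hsw z Hz))
       (is_series_scal (w - z)%C _ _ Hl)).
    assert (Hs' : @is_series C_AbsRing C_NormedModule
       (fun n => a (S n) * second_order_difference z w n)%C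
       (f w - f z - (w - z) * l)%C).
    { replace (f w - f z - (w - z) * l)%C with
        ((f w - a 0%nat) + - (f z - a 0%nat) + - ((w - z) * l))%C by ring.
      eapply is_series_ext; [|exact Hs].
      intros n; unfold second_order_difference, derived_coeff.
      change ((a (S n) * w ^ S n + - (a (S n) * z ^ S n)
         + - ((w - z) * (RtoC (INR (S n)) * a (S n) * z ^ n)))%C
         = (a (S n) * (w ^ S n - z ^ S n - RtoC (INR (S n)) * z ^ n * (w - z)))%C).
      ring. }
    replace (16 * K * rho ^ 2 * Cmod (w - z)%C ^ 2)
      with (2 * (8 * K * rho ^ 2 * Cmod (w - z)%C ^ 2)) by ring.
    apply (series_geometric_bound _ _ _ Hs').
    intros n; rewrite Cmod_mult.
    assert (H1 := second_order_difference_bound z w r n (Rlt_le _ _ Hz) (Rlt_le _ _ Hw)).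
    assert (H2 : Cmod (second_order_difference z w n)
                 <= Cmod (w - z)%C ^ 2 * (4 * r) ^ n * (8 * rho)).
    { apply Rmult_le_reg_l with r; auto.
      eapply Rle_trans; [exact H1|].
      right; rewrite Hr; field; lra. }
    apply Rle_trans with
      (K * rho ^ S n * (Cmod (w - z)%C ^ 2 * (4 * r) ^ n * (8 * rho))).
    - apply Rmult_le_compat; auto; apply Cmod_ge_0.
    - right.
      replace (/ 2) with (rho * (4 * r)) by (rewrite Hr; field; lra).
      rewrite (Rpow_mult_distr rho (4 * r)); simpl; ring. }
  apply is_derive_C_iff; intros eps.
  set (M := 16 * K * rho ^ 2 + 1).
  assert (HM : 0 < M) by (unfold M; pose proof (pow2_ge_0 rho); nra).
  assert (Hd : 0 < Rmin (r - Cmod z) (eps / M)).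
  { apply Rmin_glb_lt; [lra | apply Rdiv_lt_0_compat; [apply cond_pos | auto]]. }
  exists (mkposreal _ Hd); simpl; intros w Hw.
  assert (H1 := Rmin_l (r - Cmod z) (eps / M)).
  assert (H2 := Rmin_r (r - Cmod z) (eps / M)).
  assert (Hw' : Cmod w < r).
  { replace w with (z + (w - z))%C by ring.
    eapply Rle_lt_trans; [apply Cmod_triangle | lra]. }
  eapply Rle_trans; [apply Hest, Hw'|].
  assert (H3 : Cmod (w - z)%C * M <= eps).
  { apply Rle_trans with (eps / M * M); [apply Rmult_le_compat_r; lra|].
    right; field; lra. }
  assert (H4 := Cmod_ge_0 (w - z)%C).
  unfold M in H3; nra.
Qed.
End PowerSeries.

Lemma power_sum_derivative (a : nat -> C) (K rho : R) (f : C -> C) :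
  0 < rho -> (forall n, Cmod (a n) <= K * rho ^ n) ->
  (forall w, Cmod w < / (8 * rho) -> power_sum a w (f w)) ->
  forall z, Cmod z < / (8 * rho) ->
  power_sum (derived_coeff a) z (C_derive f z).
Proof.
  intros Hrho Ha Hf z Hz.
  assert (Hb := derived_coeff_bound a K rho Ha).
  destruct (power_sum_exists _ _ (2 * rho) ltac:(lra) Hb z) as [l Hl].
  { assert (Cmod z * (8 * rho) < 1); [|lra].
    replace 1 with (/ (8 * rho) * (8 * rho)) by (field; lra).
    apply Rmult_lt_compat_r; lra. }
  rewrite (is_C_derive_unique f z l); auto.
  eapply is_derive_power_sum; eauto.
Qed.

(** Convergence at the point 1/2 bounds [a n / 2^n]. *)
Lemma pseries_coeff_bound (f : C -> C) (a : nat -> C) :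
  (forall z : C, in_disk z -> @is_pseries C_AbsRing C_NormedModule a z (f z)) ->
  exists K : R, forall n, Cmod (a n) <= K * 2 ^ n.
Proof.
  intros H.
  assert (Hh : in_disk (RtoC (/ 2))) by (unfold in_disk; rewrite Cmod_R, Rabs_right; lra).
  specialize (power_sum_of_pseries _ _ _ (H _ Hh)); intros Hs.
  destruct (filterlim_bounded _ (ex_intro _ _ Hs)) as [M HM].
  exists (2 * M); intros n.
  assert (Hn : Cmod (a n * RtoC (/ 2) ^ n)%C <= 2 * M).
  { destruct n as [|n].
    - specialize (HM 0%nat); rewrite sum_O in HM.
      change (Cmod (a 0%nat * RtoC (/ 2) ^ 0)%C <= M) in HM.
      pose proof (Cmod_ge_0 (a 0%nat * RtoC (/ 2) ^ 0)%C); lra.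
    - assert (H1 := HM (S n)); assert (H2 := HM n).
      rewrite sum_Sn in H1.
      set (t := (a (S n) * RtoC (/ 2) ^ S n)%C) in *.
      change (Cmod (@sum_n C_AbelianGroup (fun n => a n * RtoC (/ 2) ^ n)%C n + t)%C <= M) in H1.
      change (Cmod (@sum_n C_AbelianGroup (fun n => a n * RtoC (/ 2) ^ n)%C n) <= M) in H2.
      set (S0 := @sum_n C_AbelianGroup (fun n => a n * RtoC (/ 2) ^ n)%C n) in *.
      replace t with ((S0 + t) + - S0)%C by ring.
      eapply Rle_trans; [apply Cmod_triangle|]; rewrite Cmod_opp; lra. }
  rewrite Cmod_mult, Cmod_pow, Cmod_R, (Rabs_right (/ 2)) in Hn by lra.
  apply Rmult_le_reg_r with ((/ 2) ^ n); [apply pow_lt; lra|].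
  rewrite Rmult_assoc, <- Rpow_mult_distr.
  replace (2 * / 2) with 1 by field; rewrite pow1; lra.
Qed.

(** * Expansions at the origin *)

Definition bigO (n : nat) (f : C -> C) : Prop :=
  exists K delta : R, 0 <= K /\ 0 < delta /\
    forall z, Cmod z < delta -> Cmod (f z) <= K * Cmod z ^ n.

Lemma pseries_derivatives_taylor (h : C -> C) (d : nat -> C) :
  normalized_expansion h d ->
  bigO 3 (fun z => C_derive h z -
    (1 + 2 * d 2%nat * z + 3 * d 3%nat * z ^ 2))%C /\
  bigO 3 (fun z => C_derive (C_derive h) z -
    (2 * d 2%nat + 6 * d 3%nat * z + 12 * d 4%nat * z ^ 2))%C.
Proof.
  intros [_ [Hd1 Hs]].
  destruct (pseries_coeff_bound h d Hs) as [K HK].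
  assert (HK0 := coeff_bound_nonneg d K 2 HK).
  assert (H1 : forall z, Cmod z < / 16 ->
            power_sum (derived_coeff d) z (C_derive h z)).
  { replace (/ 16) with (/ (8 * 2)) by (f_equal; ring).
    apply (power_sum_derivative d K 2); auto; [lra|].
    intros w Hw; apply power_sum_of_pseries, Hs; unfold in_disk.
    eapply Rlt_trans; [exact Hw | lra]. }
  assert (HK1 := derived_coeff_bound d K 2 HK).
  assert (H2 : forall z, Cmod z < / 32 ->
     power_sum (derived_coeff (derived_coeff d)) z (C_derive (C_derive h) z)).
  { replace (/ 32) with (/ (8 * (2 * 2))) by (f_equal; ring).
    apply (power_sum_derivative _ (K * 2) (2 * 2)); auto; [lra|].
    intros w Hw; apply H1; eapply Rlt_trans; [exact Hw | lra]. }
  assert (HK2 := derived_coeff_bound _ _ _ HK1).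
  split.
  - exists (2 * (K * 2) * (2 * 2) ^ 3), (/ 16); repeat split; try lra.
    intros z Hz.
    replace (1 + 2 * d 2%nat * z + 3 * d 3%nat * z ^ 2)%C with
      (derived_coeff d 0 + derived_coeff d 1 * z + derived_coeff d 2 * z ^ 2)%C.
    + apply (fun H => power_sum_taylor_2 _ _ _ H HK1); [lra | lra | auto].
    + unfold derived_coeff; rewrite Hd1.
      replace (INR 1) with 1 by (simpl; ring).
      replace (INR 2) with 2 by (simpl; ring).
      replace (INR 3) with 3 by (simpl; ring). ring.
  - exists (2 * (K * 2 * (2 * 2)) * (2 * (2 * 2)) ^ 3), (/ 32); repeat split; try lra.
    intros z Hz.
    replace (2 * d 2%nat + 6 * d 3%nat * z + 12 * d 4%nat * z ^ 2)%C with
      (derived_coeff (derived_coeff d) 0 + derived_coeff (derived_coeff d) 1 * z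
       + derived_coeff (derived_coeff d) 2 * z ^ 2)%C.
    + apply (fun H => power_sum_taylor_2 _ _ _ H HK2); [lra | lra | auto].
    + unfold derived_coeff.
      replace (INR 1) with 1 by (simpl; ring).
      replace (INR 2) with 2 by (simpl; ring).
      replace (INR 3) with 3 by (simpl; ring).
      replace (INR 4) with 4 by (simpl; ring).
      replace (RtoC 6) with (2 * 3)%C by (rewrite <- RtoC_mult; f_equal; ring).
      replace (RtoC 12) with (3 * 4)%C by (rewrite <- RtoC_mult; f_equal; ring).
      ring.
Qed.

Lemma bigO_ext_near (n : nat) (f g : C -> C) (r : R) :
  0 < r -> (forall z, Cmod z < r -> f z = g z) -> bigO n f -> bigO n g.
Proof.
  intros Hr He (K & e & HK & He0 & Hf).
  exists K, (Rmin r e); repeat split; auto.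
  - apply Rmin_glb_lt; auto.
  - intros z Hz; rewrite <- He.
    + apply Hf; eapply Rlt_le_trans; [exact Hz | apply Rmin_r].
    + eapply Rlt_le_trans; [exact Hz | apply Rmin_l].
Qed.

Lemma bigO_ext (n : nat) (f g : C -> C) :
  (forall z, f z = g z) -> bigO n f -> bigO n g.
Proof. intros H; apply (bigO_ext_near n f g 1); auto; lra. Qed.

Lemma bigO_plus (n : nat) (f g : C -> C) :
  bigO n f -> bigO n g -> bigO n (fun z => f z + g z)%C.
Proof.
  intros (K & e & HK & He & Hf) (L & e' & HL & He' & Hg).
  exists (K + L), (Rmin e e'); repeat split; [lra | apply Rmin_glb_lt; auto |].
  intros z Hz; eapply Rle_trans; [apply Cmod_triangle|].
  assert (H1 := Rmin_l e e'); assert (H2 := Rmin_r e e').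
  specialize (Hf z ltac:(lra)); specialize (Hg z ltac:(lra)); lra.
Qed.

Lemma bigO_mult (n m : nat) (f g : C -> C) :
  bigO n f -> bigO m g -> bigO (n + m) (fun z => f z * g z)%C.
Proof.
  intros (K & e & HK & He & Hf) (L & e' & HL & He' & Hg).
  exists (K * L), (Rmin e e'); repeat split;
    [apply Rmult_le_pos; auto | apply Rmin_glb_lt; auto |].
  intros z Hz; rewrite Cmod_mult, pow_add.
  assert (H1 := Rmin_l e e'); assert (H2 := Rmin_r e e').
  replace (K * L * (Cmod z ^ n * Cmod z ^ m)) with
    ((K * Cmod z ^ n) * (L * Cmod z ^ m)) by ring.
  apply Rmult_le_compat; try apply Cmod_ge_0; [apply Hf | apply Hg]; lra.
Qed.

Lemma bigO_weaken (n m : nat) (f : C -> C) : (n <= m)%nat -> bigO m f -> bigO n f.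
Proof.
  intros Hnm (K & e & HK & He & Hf).
  exists K, (Rmin 1 e); repeat split; auto; [apply Rmin_glb_lt; lra |].
  intros z Hz; assert (H1 := Rmin_l 1 e); assert (H2 := Rmin_r 1 e).
  eapply Rle_trans; [apply Hf; lra|].
  apply Rmult_le_compat_l; auto.
  assert (Hz0 := Cmod_ge_0 z).
  replace m with (n + (m - n))%nat by lia; rewrite pow_add.
  rewrite <- (Rmult_1_r (Cmod z ^ n)) at 2.
  apply Rmult_le_compat_l; [apply pow_le; auto|].
  rewrite <- (pow1 (m - n)); apply pow_incr; lra.
Qed.

Lemma bigO_const (c : C) : bigO 0 (fun _ => c).
Proof.
  exists (Cmod c), 1; repeat split; [apply Cmod_ge_0 | lra |].
  intros z _; simpl; lra.
Qed.

Lemma bigO_id : bigO 1 (fun z => z).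
Proof. exists 1, 1; repeat split; try lra; intros z _; simpl; lra. Qed.

Lemma bigO_scal (n : nat) (c : C) (f : C -> C) :
  bigO n f -> bigO n (fun z => c * f z)%C.
Proof. intros H; apply (bigO_mult 0 n); [apply bigO_const | auto]. Qed.

Lemma bigO_monomial (n : nat) (c : C) : bigO n (fun z => c * z ^ n)%C.
Proof.
  apply bigO_scal; exists 1, 1; repeat split; try lra.
  intros z _; rewrite Cmod_pow; lra.
Qed.

Lemma bigO_small (f : C -> C) (eps : R) :
  bigO 1 f -> 0 < eps ->
  exists r, 0 < r /\ forall z, Cmod z < r -> Cmod (f z) <= eps.
Proof.
  intros (K & e & HK & He & Hf) Heps.
  assert (Hp : 0 < eps / (K + 1)) by (apply Rdiv_lt_0_compat; lra).
  exists (Rmin e (eps / (K + 1))); split; [apply Rmin_glb_lt; auto|].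
  intros z Hz.
  assert (H1 := Rmin_l e (eps / (K + 1))); assert (H2 := Rmin_r e (eps / (K + 1))).
  specialize (Hf z ltac:(lra)).
  assert (H3 : Cmod z * (K + 1) <= eps).
  { apply Rle_trans with (eps / (K + 1) * (K + 1)).
    - apply Rmult_le_compat_r; lra.
    - right; field; lra. }
  assert (H4 := Cmod_ge_0 z); simpl in Hf; nra.
Qed.

Lemma bigO_remainder_comp (T f : C -> C) (n : nat) (K : R) :
  0 <= K -> (forall u, Cmod u <= 1 -> Cmod (T u) <= K * Cmod u ^ n) ->
  bigO 1 f -> bigO n (fun z => T (f z)).
Proof.
  intros HK HT Hf.
  destruct (bigO_small f 1 Hf ltac:(lra)) as (r & Hr & Hs).
  destruct Hf as (L & e & HL & He & Hf).
  exists (K * L ^ n), (Rmin r e); repeat split.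
  - apply Rmult_le_pos; auto; apply pow_le; auto.
  - apply Rmin_glb_lt; auto.
  - intros z Hz; assert (H1 := Rmin_l r e); assert (H2 := Rmin_r r e).
    eapply Rle_trans; [apply HT, Hs; lra|].
    rewrite Rmult_assoc, <- Rpow_mult_distr.
    apply Rmult_le_compat_l; auto; apply pow_incr; split; [apply Cmod_ge_0|].
    specialize (Hf z ltac:(lra)); simpl in Hf; lra.
Qed.

(** This is how the coefficients of [z h'' / h'] are found without dividing
    power series: it suffices to multiply a candidate by [h']. *)
Lemma bigO_quotient (A B P : C -> C) (n : nat) :
  bigO 1 (fun z => B z - 1)%C ->
  bigO n (fun z => A z - P z * B z)%C -> bigO n (fun z => A z / B z - P z)%C.
Proof.
  intros HB HA.
  destruct (bigO_small _ (/ 2) HB ltac:(lra)) as (r & Hr & Hs).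
  assert (Hlow : forall z, Cmod z < r -> / 2 <= Cmod (B z)).
  { intros z Hz; specialize (Hs z Hz).
    assert (H := Cmod_triangle (B z) (- (B z - 1))%C).
    replace (B z + - (B z - 1))%C with (RtoC 1) in H by ring.
    rewrite Cmod_1, Cmod_opp in H; lra. }
  assert (Hnz : forall z, Cmod z < r -> B z <> 0).
  { intros z Hz; apply Cmod_gt_0; specialize (Hlow z Hz); lra. }
  apply (bigO_ext_near n (fun z => (/ B z) * (A z - P z * B z))%C _ r Hr).
  { intros z Hz; field; auto. }
  apply (bigO_mult 0 n); auto.
  exists 2, r; repeat split; try lra.
  intros z Hz; simpl; rewrite Cmod_inv by auto.
  rewrite Rmult_1_r; replace 2 with (/ / 2) by field.
  apply Rinv_le_contravar; [lra | auto].
Qed.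

Lemma bigO_square (f : C -> C) (a b : C) :
  bigO 3 (fun z => f z - (a * z + b * z ^ 2))%C ->
  bigO 4 (fun z => f z * f z - (a * a * z ^ 2 + 2 * a * b * z ^ 3))%C.
Proof.
  intros H.
  apply (bigO_ext 4 (fun z =>
    (f z - (a * z + b * z ^ 2)) * ((f z - (a * z + b * z ^ 2))
      + (2 * a * z ^ 1 + 2 * b * z ^ 2)) + b * b * z ^ 4)%C).
  { intros z; ring. }
  apply bigO_plus; [|apply bigO_monomial].
  apply (bigO_mult 3 1); auto.
  apply bigO_plus; [apply (bigO_weaken 1 3); auto; lia|].
  apply bigO_plus; [apply bigO_monomial | apply (bigO_weaken 1 2); [lia | apply bigO_monomial]].
Qed.

Lemma bigO_cube (f : C -> C) (a : C) :
  bigO 2 (fun z => f z - a * z)%C ->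
  bigO 4 (fun z => f z * f z * f z - a * a * a * z ^ 3)%C.
Proof.
  intros H.
  assert (Hf : bigO 1 f).
  { apply (bigO_ext 1 (fun z => (f z - a * z) + a * z ^ 1)%C); [intros z; ring|].
    apply bigO_plus; [apply (bigO_weaken 1 2); auto; lia | apply bigO_monomial]. }
  apply (bigO_ext 4 (fun z =>
    (f z - a * z) * (f z * f z + (a * z ^ 1 * f z + a * a * z ^ 2)))%C).
  { intros z; ring. }
  apply (bigO_mult 2 2); auto.
  apply bigO_plus; [apply (bigO_mult 1 1); auto|].
  apply bigO_plus; [|apply bigO_monomial].
  apply (bigO_mult 1 1); auto; apply bigO_monomial.
Qed.

Definition cubic (a b c z : C) : C := (a * z + b * z ^ 2 + c * z ^ 3)%C.

Lemma bigO_exp_taylor (f : C -> C) (a b c : C) :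
  bigO 4 (fun z => f z - cubic a b c z)%C ->
  bigO 4 (fun z => Cexp (f z) - 1
    - cubic a (b + / 2 * (a * a)) (c + a * b + / 6 * (a * a * a)) z)%C.
Proof.
  intros H; unfold cubic in *.
  assert (H3 : bigO 3 (fun z => f z - (a * z + b * z ^ 2))%C).
  { apply (bigO_ext 3 (fun z => (f z - (a * z + b * z ^ 2 + c * z ^ 3)) + c * z ^ 3)%C);
      [intros z; ring|].
    apply bigO_plus; [apply (bigO_weaken 3 4); auto; lia | apply bigO_monomial]. }
  assert (H2 : bigO 2 (fun z => f z - a * z)%C).
  { apply (bigO_ext 2 (fun z => (f z - (a * z + b * z ^ 2)) + b * z ^ 2)%C);
      [intros z; ring|].
    apply bigO_plus; [apply (bigO_weaken 2 3); auto; lia | apply bigO_monomial]. }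
  assert (H1 : bigO 1 f).
  { apply (bigO_ext 1 (fun z => (f z - a * z) + a * z ^ 1)%C); [intros z; ring|].
    apply bigO_plus; [apply (bigO_weaken 1 2); auto; lia | apply bigO_monomial]. }
  apply (bigO_ext 4 (fun z => (Cexp (f z) - exp_taylor 3 (f z))
    + ((f z - (a * z + b * z ^ 2 + c * z ^ 3))
    + (/ 2 * (f z * f z - (a * a * z ^ 2 + 2 * a * b * z ^ 3))
    + / 6 * (f z * f z * f z - a * a * a * z ^ 3))))%C).
  { intros z; unfold exp_taylor; rewrite !RtoC_inv by lra.
    field; repeat split; intros E; apply RtoC_inj in E; lra. }
  apply bigO_plus.
  { apply (bigO_remainder_comp (fun u => Cexp u - exp_taylor 3 u)%C f 4 48); auto; [lra|].
    apply exp_taylor_bound_3. }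
  apply bigO_plus; auto.
  apply bigO_plus; apply bigO_scal; [apply bigO_square | apply bigO_cube]; auto.
Qed.

(** The logarithm of a function with a known expansion has an expansion: from
    [u = (exp u - 1) - u^2 / 2 - u^3 / 6 + O (z^4)], knowing [u] up to order
    [n] gives [u^2] and [u^3], hence [u] itself, up to order [n + 1]. *)
Lemma bigO_log_taylor (u : C -> C) (p1 p2 p3 : C) :
  bigO 1 u ->
  bigO 4 (fun z => Cexp (u z) - 1 - cubic p1 p2 p3 z)%C ->
  let u2 := (p2 - / 2 * (p1 * p1))%C in
  bigO 4 (fun z => u z - cubic p1 u2 (p3 - p1 * u2 - / 6 * (p1 * p1 * p1)) z)%C.
Proof.
  intros Hu HX u2; unfold cubic in *.
  assert (HT : bigO 4 (fun z => u z + (/ 2 * (u z * u z) + / 6 * (u z * u z * u z))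
     - (p1 * z + p2 * z ^ 2 + p3 * z ^ 3))%C).
  { apply (bigO_ext 4 (fun z => (Cexp (u z) - 1 - (p1 * z + p2 * z ^ 2 + p3 * z ^ 3))
      + (- (1)) * (Cexp (u z) - exp_taylor 3 (u z)))%C).
    { intros z; unfold exp_taylor; rewrite !RtoC_inv by lra; ring. }
    apply bigO_plus; auto; apply bigO_scal.
    apply (bigO_remainder_comp (fun u => Cexp u - exp_taylor 3 u)%C u 4 48); auto; [lra|].
    apply exp_taylor_bound_3. }
  assert (Huu : bigO 2 (fun z => u z * u z)%C) by (apply (bigO_mult 1 1); auto).
  assert (Huuu : bigO 3 (fun z => u z * u z * u z)%C) by (apply (bigO_mult 2 1); auto).
  assert (H2 : bigO 2 (fun z => u z - p1 * z)%C).
  { apply (bigO_ext 2 (fun z => (u z + (/ 2 * (u z * u z) + / 6 * (u z * u z * u z))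
     - (p1 * z + p2 * z ^ 2 + p3 * z ^ 3)) +
       (- / 2 * (u z * u z) + (- / 6 * (u z * u z * u z)
        + (p2 * z ^ 2 + p3 * z ^ 3))))%C).
    { intros z; ring. }
    apply bigO_plus; [apply (bigO_weaken 2 4); auto; lia|].
    apply bigO_plus; [apply bigO_scal; auto|].
    apply bigO_plus; [apply bigO_scal, (bigO_weaken 2 3); auto; lia|].
    apply bigO_plus; [apply bigO_monomial|].
    apply (bigO_weaken 2 3); [lia | apply bigO_monomial]. }
  assert (Hsq : bigO 3 (fun z => u z * u z - p1 * p1 * z ^ 2)%C).
  { apply (bigO_ext 3 (fun z => (u z - p1 * z) * (u z + p1 * z ^ 1))%C).
    { intros z; ring. }
    apply (bigO_mult 2 1); auto; apply bigO_plus; auto; apply bigO_monomial. }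
  assert (H3 : bigO 3 (fun z => u z - (p1 * z + u2 * z ^ 2))%C).
  { apply (bigO_ext 3 (fun z => (u z + (/ 2 * (u z * u z) + / 6 * (u z * u z * u z))
     - (p1 * z + p2 * z ^ 2 + p3 * z ^ 3)) +
       (- / 2 * (u z * u z - p1 * p1 * z ^ 2) + (- / 6 * (u z * u z * u z)
        + p3 * z ^ 3)))%C).
    { intros z; unfold u2; ring. }
    apply bigO_plus; [apply (bigO_weaken 3 4); auto; lia|].
    apply bigO_plus; [apply bigO_scal; auto|].
    apply bigO_plus; [apply bigO_scal; auto | apply bigO_monomial]. }
  apply (bigO_ext 4 (fun z => (u z + (/ 2 * (u z * u z) + / 6 * (u z * u z * u z))
     - (p1 * z + p2 * z ^ 2 + p3 * z ^ 3)) +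
       (- / 2 * (u z * u z - (p1 * p1 * z ^ 2 + 2 * p1 * u2 * z ^ 3))
        + - / 6 * (u z * u z * u z - p1 * p1 * p1 * z ^ 3)))%C).
  { intros z; unfold u2; field; repeat split; intros E; apply RtoC_inj in E; lra. }
  apply bigO_plus; auto.
  apply bigO_plus; apply bigO_scal; [apply bigO_square | apply bigO_cube]; auto.
Qed.

(** * The logarithm near 1 *)

Lemma Cexp_Clog (z : C) : 0 < Re z -> Cexp (Clog z) = z.
Proof.
  destruct z as [x y]; simpl; intros Hx.
  assert (Hm : 0 < Cmod (x, y)).
  { eapply Rlt_le_trans; [exact Hx|].
    eapply Rle_trans; [apply Rle_abs | apply (re_le_Cmod (x, y))]. }
  assert (Hs : sqrt (1 + (y / x)²) = Cmod (x, y) / x).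
  { apply Rsqr_inj; [apply sqrt_pos | left; apply Rdiv_lt_0_compat; auto|].
    rewrite Rsqr_sqrt by (pose proof (Rle_0_sqr (y / x)); lra).
    unfold Cmod; simpl; rewrite !Rsqr_div', Rsqr_sqrt by nra.
    unfold Rsqr; field; lra. }
  unfold Cexp, Clog; simpl; rewrite exp_ln by auto.
  rewrite cos_atan, sin_atan, Hs.
  apply injective_projections; simpl; field; lra.
Qed.

(** Together with the next lemma, this makes [Clog (1 - w)] of order [w]. *)
Lemma Rabs_atan_le (x : R) : Rabs (atan x) <= Rabs x.
Proof.
  destruct (MVT_gen atan 0 x (fun t => / (1 + t ^ 2))) as [c [_ Hc]].
  - intros t _; auto_derive; auto; field; nra.
  - intros t _; apply derivable_continuous_pt, derivable_pt_atan.
  - rewrite atan_0, !Rminus_0_r in Hc; rewrite Hc, Rabs_mult.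
    rewrite <- (Rmult_1_l (Rabs x)) at 2.
    apply Rmult_le_compat_r; [apply Rabs_pos|].
    rewrite Rabs_right.
    + rewrite <- Rinv_1; apply Rinv_le_contravar; nra.
    + left; apply Rinv_0_lt_compat; nra.
Qed.

Lemma Rabs_ln_le (m : R) : / 2 <= m -> Rabs (ln m) <= 2 * Rabs (m - 1).
Proof.
  intros Hm.
  destruct (MVT_gen ln 1 m (fun t => / t)) as [c [Hc E]].
  - intros t Ht; assert (Rmin 1 m >= / 2) by (apply Rle_ge, Rmin_glb; lra).
    auto_derive; lra.
  - intros t Ht; assert (Rmin 1 m >= / 2) by (apply Rle_ge, Rmin_glb; lra).
    apply derivable_continuous_pt; exists (/ t); apply derivable_pt_lim_ln; lra.
  - assert (Rmin 1 m >= / 2) by (apply Rle_ge, Rmin_glb; lra).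
    rewrite ln_1, Rminus_0_r in E; rewrite E, Rabs_mult.
    apply Rmult_le_compat_r; [apply Rabs_pos|].
    rewrite Rabs_right by (left; apply Rinv_0_lt_compat; lra).
    replace 2 with (/ / 2) by field; apply Rinv_le_contravar; lra.
Qed.

Lemma Clog_bound (w : C) :
  Cmod w <= / 2 -> Cmod (Clog (1 - w)%C) <= 4 * Cmod w.
Proof.
  intros Hw.
  replace (4 * Cmod w) with (2 * (2 * Cmod w)) by ring.
  assert (H1 : Cmod (1 - w)%C <= 1 + Cmod w).
  { eapply Rle_trans; [apply Cmod_triangle|]; rewrite Cmod_1, Cmod_opp; lra. }
  assert (H2 : 1 <= Cmod (1 - w)%C + Cmod w).
  { apply Rle_trans with (Cmod 1); [rewrite Cmod_1; lra|].
    replace (RtoC 1) with ((1 - w) + w)%C at 1 by ring.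
    apply Cmod_triangle. }
  apply Cmod_le_components; simpl.
  - eapply Rle_trans; [apply Rabs_ln_le; lra|].
    apply Rmult_le_compat_l; [lra|]. apply Rabs_le; lra.
  - eapply Rle_trans; [apply Rabs_atan_le|].
    assert (Hr := re_le_Cmod w); assert (Hi := im_le_Cmod w).
    destruct w as [x y]; simpl in *.
    assert (Hx : / 2 <= 1 + - x) by (pose proof (Rle_abs x); lra).
    rewrite Rplus_0_l; unfold Rdiv; rewrite Rabs_mult, Rabs_Ropp, Rabs_inv.
    rewrite (Rabs_right (1 + - x)) by lra.
    apply Rle_trans with (Cmod (x, y) * 2); [|lra].
    apply Rmult_le_compat; auto; [apply Rabs_pos | left; apply Rinv_0_lt_compat; lra |].
    replace 2 with (/ / 2) by field; apply Rinv_le_contravar; lra.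
Qed.

Lemma bigO_of_derivable (f : C -> C) :
  @ex_derive C_AbsRing C_NormedModule f (RtoC 0) -> f (RtoC 0) = RtoC 0 -> bigO 1 f.
Proof.
  intros [l Hl] H0.
  apply is_derive_C_iff with (eps := mkposreal 1 ltac:(lra)) in Hl.
  destruct Hl as [[r Hr] H]; simpl in H.
  exists (1 + Cmod l), r; repeat split; auto; [pose proof (Cmod_ge_0 l); lra|].
  intros z Hz; specialize (H z).
  replace (z - 0)%C with z in H by ring; rewrite H0 in H.
  specialize (H Hz).
  replace (f z) with ((f z - 0 - z * l) + z * l)%C by ring.
  eapply Rle_trans; [apply Cmod_triangle|].
  rewrite Cmod_mult; simpl; lra.
Qed.

(** * Coefficients of the Schwarz function *)

(** [144 / s^2] times the Hankel determinant, once the coefficients of [h] are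
    expressed by the coefficients [c1], [c2], [c3] of the Schwarz function. *)
Definition hankel_schwarz (s : R) (c1 c2 c3 : C) : C :=
  (6 * c1 * c3 + RtoC (3 * s + 2) * c1 ^ 2 * c2 - 4 * c2 ^ 2
   + RtoC ((2 + 3 * s - s ^ 2) / 2) * c1 ^ 4)%C.

(** With [v = Clog (1 - omega)], the subordination reads
    [exp (- s v) = 1 + z h'' / h'], while [exp v = 1 - omega].  The expansion
    of [h] gives that of [- s v] by taking a logarithm, and the expansion of
    [v] gives that of [omega] by taking an exponential. *)
Lemma schwarz_coefficients (s : R) (h omega : C -> C) (d : nat -> C) :
  0 < s -> normalized_expansion h d ->
  @ex_derive C_AbsRing C_NormedModule omega (RtoC 0) ->
  omega (RtoC 0) = RtoC 0 ->
  (forall z, in_disk z -> in_disk (omega z)) ->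
  (forall z, in_disk z -> convexity_quotient h z = q_hpl s (omega z)) ->
  exists c1 c2 c3 : C,
    bigO 4 (fun z => omega z - cubic c1 c2 c3 z)%C /\
    hankel_2_2 d = (RtoC (s ^ 2 / 144) * hankel_schwarz s c1 c2 c3)%C.
Proof.
  intros Hs Hd Hder H0 Hdisk Hq.
  destruct (pseries_derivatives_taylor h d Hd) as [Hh1 Hh2].
  set (d2 := d 2%nat) in *; set (d3 := d 3%nat) in *; set (d4 := d 4%nat) in *.
  (* p1, p2, p3 solve z h'' = (p1 z + p2 z^2 + p3 z^3) h' + O (z^4). *)
  set (p1 := (2 * d2)%C).
  set (p2 := (6 * d3 - 2 * d2 * p1)%C).
  set (p3 := (12 * d4 - 2 * d2 * p2 - 3 * d3 * p1)%C).
  assert (Hw := bigO_of_derivable omega Hder H0).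
  assert (HX : bigO 4 (fun z => z * C_derive (C_derive h) z / C_derive h z
                          - cubic p1 p2 p3 z)%C).
  { apply (bigO_quotient (fun z => z * C_derive (C_derive h) z)%C (C_derive h)).
    - apply (bigO_ext 1 (fun z => (C_derive h z - (1 + 2 * d2 * z + 3 * d3 * z ^ 2))
        + (2 * d2 * z ^ 1 + 3 * d3 * z ^ 2))%C); [intros z; ring|].
      apply bigO_plus; [apply (bigO_weaken 1 3); auto; lia|].
      apply bigO_plus; [apply bigO_monomial|].
      apply (bigO_weaken 1 2); [lia | apply bigO_monomial].
    - apply (bigO_ext 4 (fun z =>
        (z * (C_derive (C_derive h) z - (2 * d2 + 6 * d3 * z + 12 * d4 * z ^ 2)))
        + ((p1 * z ^ 1 + (p2 * z ^ 2 + p3 * z ^ 3))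
            * (- (1) * (C_derive h z - (1 + 2 * d2 * z + 3 * d3 * z ^ 2)))
        + (- (2 * d2 * p3 + 3 * d3 * p2) * z ^ 4 + - (3 * d3 * p3) * z ^ 5)))%C).
      { intros z; unfold cubic, p3, p2, p1; ring. }
      apply bigO_plus; [apply (bigO_mult 1 3); auto; apply bigO_id|].
      apply bigO_plus.
      + apply (bigO_mult 1 3); [|apply bigO_scal; auto].
        apply bigO_plus; [apply bigO_monomial|].
        apply bigO_plus; [apply (bigO_weaken 1 2) | apply (bigO_weaken 1 3)];
          try lia; apply bigO_monomial.
      + apply bigO_plus; [|apply (bigO_weaken 4 5); [lia|]]; apply bigO_monomial. }
  set (v := fun z => Clog (1 - omega z)%C).
  assert (Hv : bigO 1 v).
  { apply (bigO_small _ (/ 2)) in Hw as (r & Hr & Hsm); [|lra].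
    destruct (bigO_of_derivable omega Hder H0) as (K & e & HK & He & Hf).
    exists (4 * K), (Rmin r e); repeat split; [lra | apply Rmin_glb_lt; auto |].
    intros z Hz; assert (H1 := Rmin_l r e); assert (H2 := Rmin_r r e).
    eapply Rle_trans; [apply Clog_bound, Hsm; lra|].
    specialize (Hf z ltac:(lra)); lra. }
  assert (Hu : bigO 1 (fun z => - RtoC s * v z)%C) by (apply bigO_scal; auto).
  assert (HE : bigO 4 (fun z => Cexp (- RtoC s * v z) - 1 - cubic p1 p2 p3 z)%C).
  { refine (bigO_ext_near 4 _ _ 1 ltac:(lra) _ HX).
    intros z Hz; specialize (Hq z Hz).
    unfold convexity_quotient, q_hpl in Hq.
    unfold v; rewrite <- Hq; ring. }
  apply bigO_log_taylor in HE; auto; cbv zeta in HE.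
  set (u2 := (p2 - / 2 * (p1 * p1))%C) in HE.
  set (u3 := (p3 - p1 * u2 - / 6 * (p1 * p1 * p1))%C) in HE.
  assert (Hs' : RtoC s <> 0) by (intros E; apply RtoC_inj in E; lra).
  set (k := (- / RtoC s)%C).
  assert (HV : bigO 4 (fun z => v z - cubic (k * p1) (k * u2) (k * u3) z)%C).
  { refine (bigO_ext 4 _ _ _ (bigO_scal 4 k _ HE)).
    intros z; unfold cubic, k; field; auto. }
  apply bigO_exp_taylor in HV.
  set (c1 := (- (k * p1))%C).
  set (c2 := (- (k * u2 + / 2 * (k * p1 * (k * p1))))%C).
  set (c3 := (- (k * u3 + k * p1 * (k * u2)
                 + / 6 * (k * p1 * (k * p1) * (k * p1))))%C).
  exists c1, c2, c3; split.
  - refine (bigO_ext_near 4 _ _ 1 ltac:(lra) _ (bigO_scal 4 (- (1)) _ HV)).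
    intros z Hz; unfold v; rewrite Cexp_Clog.
    + unfold cubic, c1, c2, c3; ring.
    + specialize (Hdisk z Hz); unfold in_disk in Hdisk.
      assert (Hr := re_le_Cmod (omega z)).
      destruct (omega z) as [x y]; simpl in *.
      pose proof (Rle_abs x); lra.
  - unfold hankel_2_2, hankel_schwarz; fold d2 d3 d4.
    unfold c1, c2, c3, u3, u2, p3, p2, p1, k.
    (* Numerals are atoms for the field tactic, so they are reduced to 1 + 1. *)
    rewrite !RtoC_div by lra; rewrite !RtoC_minus, !RtoC_plus, !RtoC_mult, !RtoC_pow.
    replace (RtoC 144) with (12 * 12)%C by (rewrite <- RtoC_mult; f_equal; ring).
    replace (RtoC 12) with (2 * 6)%C by (rewrite <- RtoC_mult; f_equal; ring).
    replace (RtoC 6) with (2 * 3)%C by (rewrite <- RtoC_mult; f_equal; ring).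
    replace (RtoC 3) with (1 + 2)%C by (rewrite <- RtoC_plus; f_equal; ring).
    replace (RtoC 4) with (2 * 2)%C by (rewrite <- RtoC_mult; f_equal; ring).
    replace (RtoC 2) with (1 + 1)%C by (rewrite <- RtoC_plus; f_equal; ring).
    field; repeat split; auto;
      rewrite <- ?RtoC_plus; intros E; apply RtoC_inj in E; lra.
Qed.

(** * Goursat's theorem for closed forms *)

Lemma nested_intervals (a b : nat -> R) :
  (forall n, a n <= a (S n)) -> (forall n, b (S n) <= b n) ->
  (forall n, a n <= b n) -> exists x, forall n, a n <= x <= b n.
Proof.
  intros Ha Hb Hab.
  assert (Ham : forall n k, a n <= a (n + k)%nat).
  { intros n; induction k as [|k IH]; [rewrite Nat.add_0_r; lra|].
    rewrite Nat.add_succ_r; specialize (Ha (n + k)%nat); lra. }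
  assert (Hbm : forall n k, b (n + k)%nat <= b n).
  { intros n; induction k as [|k IH]; [rewrite Nat.add_0_r; lra|].
    rewrite Nat.add_succ_r; specialize (Hb (n + k)%nat); lra. }
  assert (Hall : forall m n, a m <= b n).
  { intros m n; specialize (Ham m n); specialize (Hbm n m).
    rewrite Nat.add_comm in Hbm; specialize (Hab (m + n)%nat); lra. }
  destruct (completeness (fun x => exists n, x = a n)) as [x [Hub Hlub]].
  - exists (b 0%nat); intros x [n ->]; auto.
  - exists (a 0%nat); eauto.
  - exists x; intros n; split.
    + apply Hub; eauto.
    + apply Hlub; intros y [m ->]; auto.
Qed.

Lemma RInt_near_const (f : R -> R) (a b k M : R) :
  a <= b -> ex_RInt f a b ->
  (forall t, a <= t <= b -> Rabs (f t - k) <= M) ->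
  Rabs (RInt f a b - k * (b - a)) <= (b - a) * M.
Proof.
  intros Hab Hex Hb.
  assert (Hk : ex_RInt (fun _ : R => k) a b) by apply ex_RInt_const.
  replace (RInt f a b - k * (b - a)) with (RInt (fun t => f t - k) a b).
  - apply abs_RInt_le_const; auto.
    apply (ex_RInt_minus (V := R_NormedModule) f (fun _ => k)); auto.
  - rewrite (RInt_minus (V := R_CompleteNormedModule) f (fun _ => k)); auto.
    rewrite RInt_const; unfold minus, plus, opp, scal; simpl.
    unfold mult; simpl; ring.
Qed.

Lemma dependent_choice_indexed (T : Type) (inv : nat -> T -> Prop)
    (step : nat -> T -> T -> Prop) (t0 : T) :
  inv 0%nat t0 ->
  (forall n t, inv n t -> exists t', inv (S n) t' /\ step n t t') ->
  exists f : nat -> T, forall n, inv n (f n) /\ step n (f n) (f (S n)).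
Proof.
  intros H0 Hstep.
  assert (Hnext : forall n t, exists t', inv n t -> inv (S n) t' /\ step n t t').
  { intros n t; destruct (classic (inv n t)) as [Hi|Hi].
    - destruct (Hstep n t Hi) as [t' Ht']; eauto.
    - exists t0; tauto. }
  set (next := fun n t => proj1_sig (constructive_indefinite_description _ (Hnext n t))).
  set (f := nat_rect (fun _ => T) t0 next).
  assert (Hnext' : forall n t, inv n t -> inv (S n) (next n t) /\ step n t (next n t)).
  { intros n t; exact (proj2_sig (constructive_indefinite_description _ (Hnext n t))). }
  assert (Hf : forall n, inv n (f n)).
  { induction n as [|n IH]; [exact H0 | apply (Hnext' n _ IH)]. }
  exists f; intros n; split; [apply Hf | apply (Hnext' n _ (Hf n))].
Qed.

(** The form [P dx + Q dy] is differentiable at the point and closed there: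
    the number [m] is both the derivative of [P] in [y] and that of [Q] in
    [x]. *)
Definition closed_form_at (P Q : R -> R -> R) (x y : R) : Prop :=
  exists px m qy : R,
    differentiable_pt_lim P x y px m /\ differentiable_pt_lim Q x y m qy.

Section Goursat.
Variables (P Q : R -> R -> R) (xmin xmax ymin ymax : R).
Hypothesis Hclosed :
  forall x y, xmin <= x <= xmax -> ymin <= y <= ymax -> closed_form_at P Q x y.

Lemma ex_RInt_horizontal (y a b : R) :
  ymin <= y <= ymax -> xmin <= a -> a <= b -> b <= xmax -> ex_RInt (fun x => P x y) a b.
Proof.
  intros Hy Ha Hab Hb; apply (ex_RInt_continuous (V := R_CompleteNormedModule)).
  rewrite Rmin_left, Rmax_right by lra; intros x Hx.
  destruct (Hclosed x y ltac:(lra) Hy) as (px & m & qy & HP & _).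
  apply continuity_pt_filterlim, derivable_continuous_pt.
  exists (px * 1 + m * 0).
  apply (derivable_pt_lim_comp_2d P (fun t => t) (fun _ => y) x px m 1 0 HP);
    [apply derivable_pt_lim_id | apply derivable_pt_lim_const].
Qed.

Lemma ex_RInt_vertical (x c d : R) :
  xmin <= x <= xmax -> ymin <= c -> c <= d -> d <= ymax -> ex_RInt (fun y => Q x y) c d.
Proof.
  intros Hx Hc Hcd Hd; apply (ex_RInt_continuous (V := R_CompleteNormedModule)).
  rewrite Rmin_left, Rmax_right by lra; intros y Hy.
  destruct (Hclosed x y Hx ltac:(lra)) as (px & m & qy & _ & HQ).
  apply continuity_pt_filterlim, derivable_continuous_pt.
  exists (m * 0 + qy * 1).
  apply (derivable_pt_lim_comp_2d Q (fun _ => x) (fun t => t) y m qy 0 1 HQ);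
    [apply derivable_pt_lim_const | apply derivable_pt_lim_id].
Qed.

Definition boundary_integral (a b c d : R) : R :=
  RInt (fun x => P x c) a b - RInt (fun x => P x d) a b
  + (RInt (fun y => Q b y) c d - RInt (fun y => Q a y) c d).

Lemma boundary_integral_split (a m b c n d : R) :
  xmin <= a -> a <= m -> m <= b -> b <= xmax ->
  ymin <= c -> c <= n -> n <= d -> d <= ymax ->
  boundary_integral a b c d =
    boundary_integral a m c n + boundary_integral m b c n
    + (boundary_integral a m n d + boundary_integral m b n d).
Proof.
  intros; unfold boundary_integral.
  assert (HP : forall y, ymin <= y <= ymax ->
    RInt (fun x => P x y) a b = RInt (fun x => P x y) a m + RInt (fun x => P x y) m b).
  { intros y Hy; symmetry.
    apply (RInt_Chasles (V := R_CompleteNormedModule)); apply ex_RInt_horizontal; lra. }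
  assert (HQ : forall x, xmin <= x <= xmax ->
    RInt (fun y => Q x y) c d = RInt (fun y => Q x y) c n + RInt (fun y => Q x y) n d).
  { intros x Hx; symmetry.
    apply (RInt_Chasles (V := R_CompleteNormedModule)); apply ex_RInt_vertical; lra. }
  rewrite (HP c), (HP d), (HQ a), (HQ b) by lra; ring.
Qed.

(** Goursat's estimate.  On a small rectangle around [(x, y)] the form differs
    from its affine part by [eps] times the size of the rectangle; the affine
    part is a closed form, and its contributions [m (c - d) (b - a)] and
    [m (b - a) (d - c)] cancel. *)
Lemma boundary_integral_local (x y eps : R) :
  xmin <= x <= xmax -> ymin <= y <= ymax -> 0 < eps ->
  exists delta, 0 < delta /\ forall a b c d,
    xmin <= a -> a <= x <= b -> b <= xmax -> ymin <= c -> c <= y <= d -> d <= ymax ->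
    b - a < delta -> d - c < delta ->
    Rabs (boundary_integral a b c d) <= 2 * eps * ((b - a) + (d - c)) ^ 2.
Proof.
  intros Hx Hy Heps.
  destruct (Hclosed x y Hx Hy) as (px & m & qy & HP & HQ).
  destruct (HP (mkposreal eps Heps)) as [d1 H1]; simpl in H1.
  destruct (HQ (mkposreal eps Heps)) as [d2 H2]; simpl in H2.
  exists (Rmin d1 d2); split; [apply Rmin_glb_lt; apply cond_pos|].
  intros a b c d Ha Hax Hb Hc Hcy Hd Hw Hh.
  assert (Hm1 := Rmin_l d1 d2); assert (Hm2 := Rmin_r d1 d2).
  set (L := (b - a) + (d - c)).
  assert (HL : forall u v, a <= u <= b -> c <= v <= d ->
            Rabs (u - x) < Rmin d1 d2 /\ Rabs (v - y) < Rmin d1 d2 /\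
            eps * Rmax (Rabs (u - x)) (Rabs (v - y)) <= eps * L).
  { intros u v Hu Hv.
    assert (Rabs (u - x) <= b - a) by (apply Rabs_le; lra).
    assert (Rabs (v - y) <= d - c) by (apply Rabs_le; lra).
    repeat split; try lra.
    apply Rmult_le_compat_l; [lra|]; unfold L; apply Rmax_lub; lra. }
  assert (EP : Rabs (RInt (fun t => P t c - P t d) a b - m * (c - d) * (b - a))
               <= (b - a) * (2 * eps * L)).
  { apply RInt_near_const; [lra | |].
    - apply (ex_RInt_minus (V := R_NormedModule) (fun t => P t c) (fun t => P t d));
        apply ex_RInt_horizontal; lra.
    - intros t Ht.
      destruct (HL t c Ht ltac:(lra)) as (K1 & K2 & K3).
      destruct (HL t d Ht ltac:(lra)) as (K4 & K5 & K6).
      specialize (H1 t c ltac:(lra) ltac:(lra)) as E1.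
      specialize (H1 t d ltac:(lra) ltac:(lra)) as E2.
      apply Rabs_le_between in E1; apply Rabs_le_between in E2.
      apply Rabs_le; lra. }
  assert (EQ : Rabs (RInt (fun t => Q b t - Q a t) c d - m * (b - a) * (d - c))
               <= (d - c) * (2 * eps * L)).
  { apply RInt_near_const; [lra | |].
    - apply (ex_RInt_minus (V := R_NormedModule) (fun t => Q b t) (fun t => Q a t));
        apply ex_RInt_vertical; lra.
    - intros t Ht.
      destruct (HL a t ltac:(lra) Ht) as (K1 & K2 & K3).
      destruct (HL b t ltac:(lra) Ht) as (K4 & K5 & K6).
      specialize (H2 a t ltac:(lra) ltac:(lra)) as E1.
      specialize (H2 b t ltac:(lra) ltac:(lra)) as E2.
      apply Rabs_le_between in E1; apply Rabs_le_between in E2.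
      apply Rabs_le; lra. }
  rewrite (RInt_minus (V := R_CompleteNormedModule) (fun t => P t c) (fun t => P t d)) in EP
    by (apply ex_RInt_horizontal; lra).
  rewrite (RInt_minus (V := R_CompleteNormedModule) (fun t => Q b t) (fun t => Q a t)) in EQ
    by (apply ex_RInt_vertical; lra).
  unfold boundary_integral.
  unfold minus, plus, opp in EP, EQ; simpl in EP, EQ.
  apply Rabs_le_between in EP; apply Rabs_le_between in EQ.
  apply Rabs_le; replace (2 * eps * L ^ 2)
    with ((b - a) * (2 * eps * L) + (d - c) * (2 * eps * L)) by (unfold L; ring).
  lra.
Qed.

Lemma bisection_step (eps w h x y : R) :
  0 <= w -> 0 <= h -> xmin <= x -> x + w <= xmax -> ymin <= y -> y + h <= ymax ->
  eps < Rabs (boundary_integral x (x + w) y (y + h)) ->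
  exists x' y',
    x <= x' /\ x' + w / 2 <= x + w /\ y <= y' /\ y' + h / 2 <= y + h /\
    eps / 4 < Rabs (boundary_integral x' (x' + w / 2) y' (y' + h / 2)).
Proof.
  intros Hw Hh Hx Hxw Hy Hyh Hbad.
  apply NNPP; intros Hno.
  assert (Hgood : forall x' y', x <= x' -> x' + w / 2 <= x + w ->
     y <= y' -> y' + h / 2 <= y + h ->
     Rabs (boundary_integral x' (x' + w / 2) y' (y' + h / 2)) <= eps / 4).
  { intros x' y' ? ? ? ?; apply Rnot_lt_le; intros ?; apply Hno.
    exists x', y'; auto. }
  apply (Rlt_not_le _ _ Hbad).
  rewrite (boundary_integral_split x (x + w / 2) (x + w) y (y + h / 2) (y + h)) by lra.
  assert (G1 := Hgood x y ltac:(lra) ltac:(lra) ltac:(lra) ltac:(lra)).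
  assert (G2 := Hgood (x + w / 2) y ltac:(lra) ltac:(lra) ltac:(lra) ltac:(lra)).
  assert (G3 := Hgood x (y + h / 2) ltac:(lra) ltac:(lra) ltac:(lra) ltac:(lra)).
  assert (G4 := Hgood (x + w / 2) (y + h / 2) ltac:(lra) ltac:(lra) ltac:(lra) ltac:(lra)).
  replace (x + w / 2 + w / 2) with (x + w) in * by field.
  replace (y + h / 2 + h / 2) with (y + h) in * by field.
  apply Rabs_le_between in G1, G2, G3, G4.
  apply Rabs_le; lra.
Qed.

(** Otherwise bisection yields nested rectangles whose integrals decrease
    like [1 / 4^n], that is, like the square of their sizes, and this
    contradicts the local estimate at their common point. *)
Theorem goursat_rectangle :
  xmin <= xmax -> ymin <= ymax -> boundary_integral xmin xmax ymin ymax = 0.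
Proof.
  intros HAB HCD.
  apply NNPP; intros Hne.
  set (eps := Rabs (boundary_integral xmin xmax ymin ymax) / 2).
  assert (Heps : 0 < eps) by (apply Rabs_pos_lt in Hne; unfold eps; lra).
  set (W := xmax - xmin); set (H := ymax - ymin).
  set (w := fun n : nat => W / 2 ^ n); set (h := fun n : nat => H / 2 ^ n).
  assert (H2n : forall n, 0 < 2 ^ n) by (intros n; apply pow_lt; lra).
  assert (Hw0 : forall n, 0 <= w n)
    by (intros n; apply Rdiv_le_0_compat; [unfold W; lra | auto]).
  assert (Hh0 : forall n, 0 <= h n)
    by (intros n; apply Rdiv_le_0_compat; [unfold H; lra | auto]).
  assert (HwS : forall n, w (S n) = w n / 2)
    by (intros n; unfold w; simpl; field; apply Rgt_not_eq, H2n).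
  assert (HhS : forall n, h (S n) = h n / 2)
    by (intros n; unfold h; simpl; field; apply Rgt_not_eq, H2n).
  set (inv := fun (n : nat) (p : R * R) =>
    (xmin <= fst p /\ fst p + w n <= xmax) /\ (ymin <= snd p /\ snd p + h n <= ymax) /\
    eps / 4 ^ n < Rabs (boundary_integral (fst p) (fst p + w n) (snd p) (snd p + h n))).
  set (step := fun (n : nat) (p p' : R * R) =>
    (fst p <= fst p' /\ fst p' + w (S n) <= fst p + w n) /\
    (snd p <= snd p' /\ snd p' + h (S n) <= snd p + h n)).
  destruct (dependent_choice_indexed (R * R) inv step (xmin, ymin)) as [f Hf].
  { unfold inv, w, h; simpl.
    replace (xmin + W / 1) with xmax by (unfold W; field).
    replace (ymin + H / 1) with ymax by (unfold H; field).
    repeat split; try lra.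
    unfold eps; apply Rabs_pos_lt in Hne; lra. }
  { intros n [x y] ([Hx1 Hx2] & [Hy1 Hy2] & Hbad); simpl in *.
    destruct (bisection_step (eps / 4 ^ n) (w n) (h n) x y)
      as (x' & y' & E1 & E2 & E3 & E4 & E5); auto.
    exists (x', y'); unfold inv, step; simpl; rewrite !HwS, !HhS.
    repeat split; try lra.
    replace (eps / (4 * 4 ^ n)) with (eps / 4 ^ n / 4); auto.
    field; apply pow_nonzero; lra. }
  destruct (nested_intervals (fun n => fst (f n)) (fun n => fst (f n) + w n)) as [x Hx].
  { intros n; destruct (Hf n) as [_ [[] _]]; auto. }
  { intros n; destruct (Hf n) as [_ [[] _]]; auto. }
  { intros n; specialize (Hw0 n); lra. }
  destruct (nested_intervals (fun n => snd (f n)) (fun n => snd (f n) + h n)) as [y Hy].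
  { intros n; destruct (Hf n) as [_ [_ []]]; auto. }
  { intros n; destruct (Hf n) as [_ [_ []]]; auto. }
  { intros n; specialize (Hh0 n); lra. }
  set (L := W + H).
  assert (HL : 0 <= L) by (unfold L, W, H; lra).
  set (e := eps / (2 * (L ^ 2 + 1))).
  assert (He : 0 < e) by (apply Rdiv_lt_0_compat; pose proof (pow2_ge_0 L); lra).
  destruct (boundary_integral_local x y e) as (delta & Hdelta & Hloc); auto.
  { destruct (Hf 0%nat) as [[[] _] _]; specialize (Hx 0%nat); simpl in Hx; lra. }
  { destruct (Hf 0%nat) as [[_ [[] _]] _]; specialize (Hy 0%nat); simpl in Hy; lra. }
  assert (Hn : exists n, L / 2 ^ n < delta).
  { destruct (Pow_x_infinity 2 ltac:(rewrite Rabs_right; lra) (L / delta + 1)) as [N HN].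
    exists N; specialize (HN N (le_n N)).
    rewrite Rabs_right in HN by (apply Rle_ge, Rlt_le, H2n).
    apply Rmult_lt_reg_r with (2 ^ N); auto.
    replace (L / 2 ^ N * 2 ^ N) with L by (field; apply Rgt_not_eq, H2n).
    replace L with (L / delta * delta) by (field; lra).
    rewrite (Rmult_comm delta); apply Rmult_lt_compat_r; lra. }
  destruct Hn as [n Hn].
  destruct (Hf n) as [([Hx1 Hx2] & [Hy1 Hy2] & Hbad) _].
  specialize (Hx n); specialize (Hy n); simpl in Hx, Hy.
  assert (Hsum : w n + h n = L / 2 ^ n)
    by (unfold w, h, L; field; apply Rgt_not_eq, H2n).
  specialize (Hw0 n); specialize (Hh0 n).
  specialize (Hloc (fst (f n)) (fst (f n) + w n) (snd (f n)) (snd (f n) + h n)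
    ltac:(lra) ltac:(lra) ltac:(lra) ltac:(lra) ltac:(lra) ltac:(lra) ltac:(lra) ltac:(lra)).
  replace (fst (f n) + w n - fst (f n) + (snd (f n) + h n - snd (f n)))
    with (L / 2 ^ n) in Hloc by (rewrite <- Hsum; ring).
  apply (Rlt_not_le _ _ Hbad); eapply Rle_trans; [exact Hloc|].
  replace (4 ^ n) with (2 ^ n * 2 ^ n)
    by (rewrite <- Rpow_mult_distr; f_equal; ring).
  replace (2 * e * (L / 2 ^ n) ^ 2) with (eps / (2 ^ n * 2 ^ n) * (L ^ 2 / (L ^ 2 + 1))).
  - rewrite <- (Rmult_1_r (eps / (2 ^ n * 2 ^ n))) at 2.
    specialize (H2n n); assert (0 < 2 ^ n * 2 ^ n) by nra.
    apply Rmult_le_compat_l; [apply Rlt_le, Rdiv_lt_0_compat; auto|].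
    assert (HL2 := pow2_ge_0 L).
    apply Rmult_le_reg_r with (L ^ 2 + 1); [lra|].
    unfold Rdiv; rewrite Rmult_assoc, Rinv_l by lra; lra.
  - unfold e; field; split; [apply Rgt_not_eq, H2n | pose proof (pow2_ge_0 L); lra].
Qed.

End Goursat.

(** * Means over the circle *)

Lemma two_PI_pos : 0 < 2 * PI.
Proof. pose proof PI_RGT_0; lra. Qed.

Definition circle_mean (f : R -> C) (l : C) : Prop :=
  is_RInt (fun t => Re (f t)) 0 (2 * PI) (2 * PI * Re l) /\
  is_RInt (fun t => Im (f t)) 0 (2 * PI) (2 * PI * Im l).

Lemma circle_mean_ext (f g : R -> C) (l m : C) :
  (forall t, f t = g t) -> l = m -> circle_mean f l -> circle_mean g m.
Proof.
  intros H <- [HR HI]; split; eapply is_RInt_ext; eauto; intros t _; simpl;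
    rewrite H; reflexivity.
Qed.

Lemma circle_mean_plus (f g : R -> C) (l m : C) :
  circle_mean f l -> circle_mean g m -> circle_mean (fun t => f t + g t)%C (l + m)%C.
Proof.
  intros [H1 H2] [H3 H4]; split.
  - replace (2 * PI * Re (l + m)%C) with (plus (2 * PI * Re l) (2 * PI * Re m))
      by (destruct l, m; unfold plus; simpl; ring).
    exact (is_RInt_plus _ _ _ _ _ _ H1 H3).
  - replace (2 * PI * Im (l + m)%C) with (plus (2 * PI * Im l) (2 * PI * Im m))
      by (destruct l, m; unfold plus; simpl; ring).
    exact (is_RInt_plus _ _ _ _ _ _ H2 H4).
Qed.

Lemma circle_mean_scal (c : C) (f : R -> C) (l : C) :
  circle_mean f l -> circle_mean (fun t => c * f t)%C (c * l)%C.
Proof.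
  intros [H1 H2]; split.
  - replace (2 * PI * Re (c * l)%C) with
      (plus (scal (Re c) (2 * PI * Re l)) (opp (scal (Im c) (2 * PI * Im l))))
      by (destruct c, l; unfold plus, opp, scal; simpl; unfold mult; simpl; ring).
    eapply is_RInt_ext;
      [|exact (is_RInt_minus _ _ _ _ _ _ (is_RInt_scal _ _ _ (Re c) _ H1)
                  (is_RInt_scal _ _ _ (Im c) _ H2))].
    intros t _; destruct c, (f t).
    unfold minus, plus, opp, scal; simpl; unfold mult; simpl; ring.
  - replace (2 * PI * Im (c * l)%C) with
      (plus (scal (Re c) (2 * PI * Im l)) (scal (Im c) (2 * PI * Re l)))
      by (destruct c, l; unfold plus, opp, scal; simpl; unfold mult; simpl; ring).
    eapply is_RInt_ext;
      [|exact (is_RInt_plus _ _ _ _ _ _ (is_RInt_scal _ _ _ (Re c) _ H2)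
                  (is_RInt_scal _ _ _ (Im c) _ H1))].
    intros t _; destruct c, (f t).
    unfold plus, scal; simpl; unfold mult; simpl; ring.
Qed.

Lemma circle_mean_Re_nonneg (f : R -> C) (l : C) :
  circle_mean f l -> (forall t, 0 <= Re (f t)) -> 0 <= Re l.
Proof.
  intros [H _] Hf; assert (Hp := two_PI_pos).
  assert (H0 : 0 <= 2 * PI * Re l).
  { apply (is_RInt_le (fun _ => 0) (fun t => Re (f t)) 0 (2 * PI)); try lra; auto.
    replace 0 with (scal (2 * PI - 0) 0) at 2 by (unfold scal; simpl; unfold mult; simpl; ring).
    apply (is_RInt_const (V := R_NormedModule)). }
  nra.
Qed.

Lemma circle_mean_bound (f : R -> C) (l : C) (M : R) :
  circle_mean f l -> (forall t, Cmod (f t) <= M) -> Cmod l <= 2 * M.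
Proof.
  intros [H1 H2] Hf; assert (Hp := two_PI_pos).
  assert (Hb : forall (g : R -> R) v, is_RInt g 0 (2 * PI) (2 * PI * v) ->
    (forall t, Rabs (g t) <= M) -> Rabs v <= M).
  { intros g v Hg HM.
    assert (E : Rabs (2 * PI * v) <= (2 * PI - 0) * M).
    { rewrite <- (is_RInt_unique _ _ _ _ Hg).
      apply abs_RInt_le_const; [lra | eexists; eauto | auto]. }
    rewrite Rabs_mult, (Rabs_right (2 * PI)) in E by lra; nra. }
  apply Cmod_le_components.
  - apply (Hb (fun t => Re (f t))); auto.
    intros t; eapply Rle_trans; [apply re_le_Cmod | auto].
  - apply (Hb (fun t => Im (f t))); auto.
    intros t; eapply Rle_trans; [apply im_le_Cmod | auto].
Qed.

Definition character (n : Z) (t : R) : C := (cos (IZR n * t), sin (IZR n * t)).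

Lemma character_add (n m : Z) (t : R) :
  (character n t * character m t)%C = character (n + m) t.
Proof.
  unfold character; rewrite plus_IZR, Rmult_plus_distr_r, cos_plus, sin_plus.
  apply injective_projections; simpl; ring.
Qed.

Lemma character_0 (t : R) : character 0 t = RtoC 1.
Proof. unfold character; rewrite Rmult_0_l, cos_0, sin_0; reflexivity. Qed.

Lemma character_conj (n : Z) (t : R) : Cconj (character n t) = character (- n) t.
Proof.
  unfold character, Cconj; simpl.
  rewrite opp_IZR, Ropp_mult_distr_l_reverse, cos_neg, sin_neg; reflexivity.
Qed.

Lemma Cexp_polar (n : Z) (a t : R) :
  Cexp (RtoC (IZR n) * (a, t))%C = (RtoC (exp (IZR n * a)) * character n t)%C.
Proof.
  unfold Cexp, character; simpl.
  replace (IZR n * a - 0 * t) with (IZR n * a) by ring.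
  replace (IZR n * t + 0 * a) with (IZR n * t) by ring.
  apply injective_projections; simpl; ring.
Qed.

Lemma character_2PI (n : Z) : character n (2 * PI) = RtoC 1.
Proof.
  unfold character.
  assert (Hs : sin (IZR n * PI) = 0) by (apply sin_eq_0_1; exists n; reflexivity).
  replace (IZR n * (2 * PI)) with (2 * (IZR n * PI)) by ring.
  rewrite cos_2a_sin, sin_2a, Hs.
  apply injective_projections; simpl; ring.
Qed.

Lemma circle_mean_const (c : C) : circle_mean (fun _ => c) c.
Proof.
  split.
  - replace (2 * PI * Re c) with (scal (2 * PI - 0) (Re c))
      by (unfold scal; simpl; unfold mult; simpl; ring).
    apply (is_RInt_const (V := R_NormedModule)).
  - replace (2 * PI * Im c) with (scal (2 * PI - 0) (Im c))
      by (unfold scal; simpl; unfold mult; simpl; ring).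
    apply (is_RInt_const (V := R_NormedModule)).
Qed.

Lemma circle_mean_character (n : Z) :
  circle_mean (character n) (if Z.eqb n 0 then RtoC 1 else RtoC 0).
Proof.
  destruct (Z.eqb_spec n 0) as [->|Hn].
  - apply (circle_mean_ext (fun _ => RtoC 1) _ (RtoC 1)); auto.
    + intros t; symmetry; apply character_0.
    + apply circle_mean_const.
  - assert (Hn' : IZR n <> 0) by (apply not_0_IZR; auto).
    assert (H2 := character_2PI n); assert (H0 : character n 0 = RtoC 1)
      by (unfold character; rewrite Rmult_0_r, cos_0, sin_0; reflexivity).
    unfold character in H2, H0; injection H2 as Hc2 Hs2; injection H0 as Hc0 Hs0.
    split; simpl.
    + replace (2 * PI * 0) with
        (minus (sin (IZR n * (2 * PI)) / IZR n) (sin (IZR n * 0) / IZR n))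
        by (rewrite Hs2, Hs0; unfold minus, plus, opp; simpl; field; auto).
      apply (is_RInt_derive (V := R_CompleteNormedModule) (fun t => sin (IZR n * t) / IZR n)).
      * intros t _; auto_derive; auto; field; auto.
      * intros t _; apply continuity_pt_filterlim.
        apply derivable_continuous_pt; reg.
    + replace (2 * PI * 0) with
        (minus (- cos (IZR n * (2 * PI)) / IZR n) (- cos (IZR n * 0) / IZR n))
        by (rewrite Hc2, Hc0; unfold minus, plus, opp; simpl; field; auto).
      apply (is_RInt_derive (V := R_CompleteNormedModule) (fun t => - cos (IZR n * t) / IZR n)).
      * intros t _; auto_derive; auto; field; auto.
      * intros t _; apply continuity_pt_filterlim.
        apply derivable_continuous_pt; reg.
Qed.

Lemma is_derive_C_differentiable (G : C -> C) (x y : R) (l : C) :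
  @is_derive C_AbsRing C_NormedModule G (x, y) l ->
  differentiable_pt_lim (fun u v => Re (G (u, v))) x y (Re l) (- Im l) /\
  differentiable_pt_lim (fun u v => Im (G (u, v))) x y (Im l) (Re l).
Proof.
  intros H.
  assert (Hcore : forall eps : posreal, exists d : posreal, forall u v,
     Rabs (u - x) < d -> Rabs (v - y) < d ->
     Cmod (G (u, v) - G (x, y) - ((u, v) - (x, y)) * l)%C
       <= eps * Rmax (Rabs (u - x)) (Rabs (v - y))).
  { intros eps.
    assert (He : 0 < eps / 2) by (pose proof (cond_pos eps); lra).
    destruct (proj1 (is_derive_C_iff G (x, y) l) H (mkposreal _ He)) as [d Hd].
    assert (Hd2 : 0 < d / 2) by (pose proof (cond_pos d); lra).
    exists (mkposreal _ Hd2); simpl; intros u v Hu Hv.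
    assert (Hc : Cmod ((u, v) - (x, y))%C <= 2 * Rmax (Rabs (u - x)) (Rabs (v - y))).
    { apply Cmod_le_components; simpl; [apply Rmax_l | apply Rmax_r]. }
    eapply Rle_trans; [apply Hd|simpl].
    - eapply Rle_lt_trans; [exact Hc|].
      assert (Rmax (Rabs (u - x)) (Rabs (v - y)) < d / 2) by (apply Rmax_lub_lt; auto).
      lra.
    - pose proof (cond_pos eps); nra. }
  split; intros eps; destruct (Hcore eps) as [d Hd]; exists d; intros u v Hu Hv;
    (eapply Rle_trans; [|apply (Hd u v Hu Hv)]).
  - eapply Rle_trans; [|apply re_le_Cmod]; right; f_equal.
    destruct l, (G (u, v)), (G (x, y)); simpl; ring.
  - eapply Rle_trans; [|apply im_le_Cmod]; right; f_equal.
    destruct l, (G (u, v)), (G (x, y)); simpl; ring.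
Qed.

Lemma differentiable_pt_lim_opp (f : R -> R -> R) (x y lx ly : R) :
  differentiable_pt_lim f x y lx ly ->
  differentiable_pt_lim (fun u v => - f u v) x y (- lx) (- ly).
Proof.
  intros H eps; destruct (H eps) as [d Hd]; exists d; intros u v Hu Hv.
  rewrite <- Rabs_Ropp; eapply Rle_trans; [|apply (Hd u v Hu Hv)].
  right; f_equal; ring.
Qed.

(** The real and imaginary parts of [- i G dw], oriented so that the
    coefficient of [dy] is the function to be averaged. *)
Lemma holomorphic_closed_forms (G : C -> C) (x y : R) :
  @ex_derive C_AbsRing C_NormedModule G (x, y) ->
  closed_form_at (fun u v => Im (G (u, v))) (fun u v => Re (G (u, v))) x y /\
  closed_form_at (fun u v => - Re (G (u, v))) (fun u v => Im (G (u, v))) x y.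
Proof.
  intros [l Hl]; destruct (is_derive_C_differentiable G x y l Hl) as [HR HI]; split.
  - exists (Im l), (Re l), (- Im l); auto.
  - exists (- Re l), (Im l), (Re l); split; auto.
    replace (Im l) with (- - Im l) by ring; apply differentiable_pt_lim_opp; auto.
Qed.

(** For a function of period [2 i PI] the integrals over the two horizontal
    sides of a rectangle of height [2 PI] cancel, so Goursat's theorem equates
    the integrals over the two vertical ones.  Composed with [exp], vertical
    segments become circles around 0: this is the independence of the radius
    in Cauchy's integral formula, obtained without a punctured disk. *)
Theorem periodic_circle_mean (G : C -> C) :
  (forall w, Re w < 0 -> @ex_derive C_AbsRing C_NormedModule G w) ->
  (forall x, x < 0 -> G (x, 2 * PI) = G (x, 0)) ->
  exists l, forall a, a < 0 -> circle_mean (fun t => G (a, t)) l.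
Proof.
  intros Hhol Hper; assert (Hp := two_PI_pos).
  assert (Hinv : forall P Q : R -> R -> R,
    (forall x y, x < 0 -> closed_form_at P Q x y) ->
    (forall x, x < 0 -> P x (2 * PI) = P x 0) ->
    forall a, a < 0 -> is_RInt (Q a) 0 (2 * PI) (RInt (Q (- 1)) 0 (2 * PI))).
  { intros P Q Hcl HP.
    assert (Hex : forall a, a < 0 -> ex_RInt (Q a) 0 (2 * PI)).
    { intros a Ha; apply (ex_RInt_vertical P Q a a 0 (2 * PI)); try lra.
      intros x y Hx _; apply Hcl; lra. }
    assert (Heq : forall a b, a <= b -> b < 0 ->
       RInt (Q a) 0 (2 * PI) = RInt (Q b) 0 (2 * PI)).
    { intros a b Hab Hb.
      assert (Hg := goursat_rectangle P Q a b 0 (2 * PI)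
        ltac:(intros; apply Hcl; lra) Hab ltac:(lra)).
      unfold boundary_integral in Hg.
      rewrite (RInt_ext (fun x => P x (2 * PI)) (fun x => P x 0)) in Hg.
      - change (fun y => Q b y) with (Q b) in Hg;
        change (fun y => Q a y) with (Q a) in Hg; lra.
      - intros x Hx; rewrite Rmax_right in Hx by lra; apply HP; lra. }
    intros a Ha.
    replace (RInt (Q (-1)) 0 (2 * PI)) with (RInt (Q a) 0 (2 * PI)).
    - apply (RInt_correct (V := R_CompleteNormedModule)); auto.
    - destruct (Rle_dec a (-1)); [apply Heq | symmetry; apply Heq]; lra. }
  set (IR := RInt (fun t => Re (G (-1, t))) 0 (2 * PI)).
  set (II := RInt (fun t => Im (G (-1, t))) 0 (2 * PI)).
  assert (Hdiv : forall r : R, 2 * PI * (r / (2 * PI)) = r) by (intros r; field; lra).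
  exists (IR / (2 * PI), II / (2 * PI)); intros a Ha; split; simpl.
  - rewrite Hdiv.
    apply (Hinv (fun u v => Im (G (u, v))) (fun u v => Re (G (u, v)))); auto.
    + intros x y Hx; apply holomorphic_closed_forms, Hhol; auto.
    + intros x Hx; rewrite Hper; auto.
  - rewrite Hdiv.
    apply (Hinv (fun u v => - Re (G (u, v))) (fun u v => Im (G (u, v)))); auto.
    + intros x y Hx; apply holomorphic_closed_forms, Hhol; auto.
    + intros x Hx; rewrite Hper; auto.
Qed.

Definition cubic_coeff (c1 c2 c3 : C) (m : Z) : C :=
  if Z.eqb m 1 then c1 else if Z.eqb m 2 then c2 else if Z.eqb m 3 then c3
  else RtoC 0.

Lemma circle_mean_Cexp (n : Z) (a : R) :
  circle_mean (fun t => Cexp (RtoC (IZR n) * (a, t))%C)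
    (if Z.eqb n 0 then RtoC 1 else RtoC 0).
Proof.
  eapply circle_mean_ext;
    [| |apply (circle_mean_scal (RtoC (exp (IZR n * a))) _ _ (circle_mean_character n))].
  - intros t; symmetry; apply Cexp_polar.
  - destruct (Z.eqb_spec n 0) as [->|_]; [rewrite Rmult_0_l, exp_0|]; ring.
Qed.

Lemma Cexp_shift (k : nat) (m : Z) (w : C) :
  Cexp (RtoC (IZR (Z.of_nat k - m)) * w)%C
    = (Cexp w ^ k * Cexp (RtoC (IZR (- m)) * w))%C.
Proof.
  induction k as [|k IH]; [simpl; rewrite Cmult_1_l; reflexivity|].
  replace (Z.of_nat (S k) - m)%Z with (1 + (Z.of_nat k - m))%Z by lia.
  rewrite plus_IZR, RtoC_plus, Cmult_plus_distr_r, Cexp_plus, IH, Cmult_1_l.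
  simpl; ring.
Qed.

Lemma in_disk_Cexp (w : C) : Re w < 0 -> in_disk (Cexp w).
Proof.
  intros H; unfold in_disk; rewrite Cmod_Cexp, <- exp_0; apply exp_increasing; auto.
Qed.

Lemma is_derive_C_AbsRing (f : C -> C) (z l : C) :
  @is_derive C_AbsRing C_NormedModule f z l <->
  @is_derive C_AbsRing (AbsRing_NormedModule C_AbsRing) f z l.
Proof.
  split; intros [_ H]; (split; [apply is_linear_scal_l|]);
    intros x Hx eps; exact (H x Hx eps).
Qed.

Lemma ex_derive_C_mult (f g : C -> C) (z : C) :
  @ex_derive C_AbsRing C_NormedModule f z ->
  @ex_derive C_AbsRing C_NormedModule g z ->
  @ex_derive C_AbsRing C_NormedModule (fun w => f w * g w)%C z.
Proof.
  intros [df Hf] [dg Hg]; eexists.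
  apply is_derive_C_AbsRing in Hf, Hg; apply is_derive_C_AbsRing.
  exact (is_derive_mult (K := C_AbsRing) f g z df dg Hf Hg Cmult_comm).
Qed.

Lemma ex_derive_C_comp (f g : C -> C) (z : C) :
  @ex_derive C_AbsRing C_NormedModule f (g z) ->
  @ex_derive C_AbsRing C_NormedModule g z ->
  @ex_derive C_AbsRing C_NormedModule (fun w => f (g w)) z.
Proof.
  intros [df Hf] [dg Hg]; eexists.
  apply is_derive_C_AbsRing in Hg.
  exact (is_derive_comp (K := C_AbsRing) (V := C_NormedModule) f g z df dg Hf Hg).
Qed.

Lemma ex_derive_C_scal (c z : C) :
  @ex_derive C_AbsRing C_NormedModule (fun w => c * w)%C z.
Proof.
  exists c; apply is_derive_C_iff; intros eps; exists (mkposreal 1 Rlt_0_1).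
  intros w _; replace (c * w - c * z - (w - z) * c)%C with (RtoC 0) by ring.
  rewrite Cmod_0; apply Rmult_le_pos; [left; apply cond_pos | apply Cmod_ge_0].
Qed.

(** The means of [omega (z) / z^m] on all circles around 0 are equal; on a
    small circle of radius [r] the expansion of [omega] makes them equal to
    its [m]-th coefficient up to [O (r)].  The values [m <= 0] are included
    and give 0. *)
Lemma circle_mean_coeff (omega : C -> C) (c1 c2 c3 : C) (m : Z) (a : R) :
  holomorphic_on_disk omega ->
  bigO 4 (fun z => omega z - cubic c1 c2 c3 z)%C ->
  (m <= 3)%Z -> a < 0 ->
  circle_mean (fun t => omega (Cexp (a, t)) * character (- m) t)%C
    (RtoC (exp (IZR m * a)) * cubic_coeff c1 c2 c3 m)%C.
Proof.
  intros Hol Hbig Hm Ha.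
  set (G := fun w => (omega (Cexp w) * Cexp (RtoC (IZR (- m)) * w))%C).
  destruct (periodic_circle_mean G) as [l Hl].
  { intros w Hw.
    apply (ex_derive_C_mult (fun w => omega (Cexp w))).
    - apply (ex_derive_C_comp omega Cexp); [apply Hol, in_disk_Cexp; auto|].
      eexists; apply is_derive_Cexp.
    - apply (ex_derive_C_comp Cexp).
      + eexists; apply is_derive_Cexp.
      + apply ex_derive_C_scal. }
  { intros x Hx; unfold G; rewrite !Cexp_polar.
    assert (E : forall t, Cexp (x, t) = (RtoC (exp x) * character 1 t)%C).
    { intros t; rewrite <- (Rmult_1_l x) at 2; rewrite <- (Cexp_polar 1 x t).
      f_equal; symmetry; apply Cmult_1_l. }
    rewrite !E, !character_2PI; unfold character; rewrite !Rmult_0_r, cos_0, sin_0.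
    reflexivity. }
  assert (Hlc : l = cubic_coeff c1 c2 c3 m).
  { destruct Hbig as (K & delta & HK & Hdelta & Hb).
    apply NNPP; intros Hne.
    set (e := Cmod (l - cubic_coeff c1 c2 c3 m)%C).
    assert (He : 0 < e).
    { apply Cmod_gt_0; intros E; apply Hne.
      replace l with ((l - cubic_coeff c1 c2 c3 m) + cubic_coeff c1 c2 c3 m)%C by ring.
      rewrite E; ring. }
    (* A radius so small that the error 2 K r is less than the discrepancy e. *)
    set (r := Rmin (Rmin delta (e / (2 * K + 1))) 1 / 2).
    assert (Hq : 0 < e / (2 * K + 1)) by (apply Rdiv_lt_0_compat; lra).
    assert (Hr0 : 0 < Rmin (Rmin delta (e / (2 * K + 1))) 1)
      by (repeat apply Rmin_glb_lt; lra).
    assert (Hr1 := Rmin_l (Rmin delta (e / (2 * K + 1))) 1).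
    assert (Hr2 := Rmin_r (Rmin delta (e / (2 * K + 1))) 1).
    assert (Hr3 := Rmin_l delta (e / (2 * K + 1))).
    assert (Hr4 := Rmin_r delta (e / (2 * K + 1))).
    assert (Hr : 0 < r /\ r < 1 /\ r < delta /\ r < e / (2 * K + 1))
      by (unfold r; lra).
    destruct Hr as (Hrp & Hr1' & Hrd & Hre).
    set (b := ln r).
    assert (Hexpb : exp b = r) by (apply exp_ln; auto).
    assert (Hb0 : b < 0) by (unfold b; rewrite <- ln_1; apply ln_increasing; auto).
    assert (Hmean := circle_mean_plus _ _ _ _ (Hl b Hb0)
      (circle_mean_scal (- (1))%C _ _
      (circle_mean_plus _ _ _ _
        (circle_mean_scal c1 _ _ (circle_mean_Cexp (Z.of_nat 1 - m) b))
      (circle_mean_plus _ _ _ _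
        (circle_mean_scal c2 _ _ (circle_mean_Cexp (Z.of_nat 2 - m) b))
        (circle_mean_scal c3 _ _ (circle_mean_Cexp (Z.of_nat 3 - m) b)))))).
    apply (circle_mean_bound _ _ (K * r)) in Hmean.
    - match type of Hmean with Cmod ?x <= _ =>
        replace x with (l - cubic_coeff c1 c2 c3 m)%C in Hmean end.
      + fold e in Hmean.
        assert (r * (2 * K + 1) < e); [|lra].
        replace e with (e / (2 * K + 1) * (2 * K + 1)) by (field; lra).
        apply Rmult_lt_compat_r; lra.
      + unfold cubic_coeff.
        destruct (Z.eqb_spec m 1), (Z.eqb_spec m 2), (Z.eqb_spec m 3),
          (Z.eqb_spec (Z.of_nat 1 - m) 0), (Z.eqb_spec (Z.of_nat 2 - m) 0),
          (Z.eqb_spec (Z.of_nat 3 - m) 0); try lia; ring.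
    - intros t; rewrite !Cexp_shift; unfold G.
      set (z := Cexp (b, t)).
      replace (omega z * _ + _)%C with
        ((omega z - cubic c1 c2 c3 z) * Cexp (RtoC (IZR (- m)) * (b, t)))%C
        by (unfold cubic; ring).
      assert (Hz : Cmod z = r) by (unfold z; rewrite Cmod_Cexp; exact Hexpb).
      rewrite Cmod_mult, Cmod_Cexp.
      apply Rle_trans with (K * Cmod z ^ 4 * exp (Re (RtoC (IZR (- m)) * (b, t))%C)).
      { apply Rmult_le_compat_r; [left; apply exp_pos | apply Hb; lra]. }
      rewrite Hz, Rmult_assoc; apply Rmult_le_compat_l; auto.
      replace (Re (RtoC (IZR (- m)) * (b, t))%C) with (- IZR m * b)
        by (rewrite opp_IZR; simpl; ring).
      rewrite <- Hexpb at 1; rewrite <- Hexpb.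
      replace (exp b ^ 4) with (exp (4 * b))
        by (replace (4 * b) with (b + (b + (b + b))) by ring; rewrite !exp_plus; ring).
      rewrite <- exp_plus.
      assert (Hm3 : IZR m <= 3) by (apply (IZR_le m 3); auto).
      assert (Hle : 4 * b + - IZR m * b <= b) by nra.
      destruct Hle as [Hlt|Heq]; [left; apply exp_increasing; auto | rewrite Heq; lra]. }
  subst l.
  apply (circle_mean_ext (fun t => RtoC (exp (IZR m * a)) * G (a, t))%C _
    (RtoC (exp (IZR m * a)) * cubic_coeff c1 c2 c3 m)%C); auto.
  - intros t; unfold G; rewrite Cexp_polar, opp_IZR.
    replace (- IZR m * a) with (- (IZR m * a)) by ring.
    rewrite exp_Ropp, RtoC_inv by (apply Rgt_not_eq, exp_pos).
    field; intros E; apply RtoC_inj in E; revert E; apply Rgt_not_eq, exp_pos.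
  - apply circle_mean_scal; auto.
Qed.

(** * Toeplitz contractions *)

Definition trig_poly (p0 p1 p2 : C) (t : R) : C :=
  (p0 + p1 * character 1 t + p2 * character 2 t)%C.

(** The sesquilinear form attached to [f] has the Toeplitz matrix of the
    Fourier coefficients of [f]. *)
Lemma circle_mean_pairing (f : R -> C) (F : Z -> C) (p0 p1 p2 q0 q1 q2 : C) :
  (forall m, (-2 <= m <= 2)%Z -> circle_mean (fun t => f t * character (- m) t)%C (F m)) ->
  circle_mean (fun t => f t * trig_poly p0 p1 p2 t * Cconj (trig_poly q0 q1 q2 t))%C
    (Cconj q0 * (p0 * F 0%Z + p1 * F (-1)%Z + p2 * F (-2)%Z)
     + Cconj q1 * (p0 * F 1%Z + p1 * F 0%Z + p2 * F (-1)%Z)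
     + Cconj q2 * (p0 * F 2%Z + p1 * F 1%Z + p2 * F 0%Z))%C.
Proof.
  intros H.
  assert (H0 := H 0%Z ltac:(lia)); assert (H1 := H 1%Z ltac:(lia)).
  assert (H2 := H 2%Z ltac:(lia)); assert (Hm1 := H (-1)%Z ltac:(lia)).
  assert (Hm2 := H (-2)%Z ltac:(lia)).
  assert (Hrow : forall (q : C) (g0 g1 g2 : R -> C) (l0 l1 l2 : C),
    circle_mean g0 l0 -> circle_mean g1 l1 -> circle_mean g2 l2 ->
    circle_mean (fun t => q * (p0 * g0 t + p1 * g1 t + p2 * g2 t))%C
      (q * (p0 * l0 + p1 * l1 + p2 * l2))%C).
  { intros; apply circle_mean_scal; repeat apply circle_mean_plus;
      apply circle_mean_scal; auto. }
  eapply circle_mean_ext; [|reflexivity|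
    exact (circle_mean_plus _ _ _ _ (circle_mean_plus _ _ _ _
      (Hrow (Cconj q0) _ _ _ _ _ _ H0 Hm1 Hm2) (Hrow (Cconj q1) _ _ _ _ _ _ H1 H0 Hm1))
      (Hrow (Cconj q2) _ _ _ _ _ _ H2 H1 H0))].
  intros t; unfold trig_poly.
  rewrite !Cplus_conj, !Cmult_conj, !character_conj.
  simpl (- _)%Z.
  assert (E1 : (character 1 t * character (-1) t)%C = RtoC 1)
    by (rewrite character_add; apply character_0).
  assert (E2 : character 2 t = (character 1 t * character 1 t)%C)
    by (rewrite character_add; reflexivity).
  assert (E3 : character (-2) t = (character (-1) t * character (-1) t)%C)
    by (rewrite character_add; reflexivity).
  rewrite E2, E3, character_0.
  set (x := character 1 t) in *; set (y := character (-1) t) in *.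
  transitivity (f t * (Cconj q0 * (p0 * 1 + p1 * x + p2 * (x * x))
    + Cconj q1 * (p0 * y + p1 * 1 + p2 * x)
    + Cconj q2 * (p0 * (y * y) + p1 * y + p2 * 1)))%C; [ring|].
  transitivity (f t * (Cconj q0 * (p0 * 1 + p1 * x + p2 * (x * x))
    + Cconj q1 * (p0 * y + p1 * (x * y) + p2 * (x * (x * y)))
    + Cconj q2 * (p0 * (y * y) + p1 * (y * (x * y)) + p2 * ((x * y) * (x * y)))))%C;
    [rewrite E1; ring | ring].
Qed.

Definition sqnorm3 (x y z : C) : R := Cmod x ^ 2 + Cmod y ^ 2 + Cmod z ^ 2.

(** The squared norm of the lower triangular Toeplitz operator with entries
    [c1], [c2], [c3] is at most [kappa]. *)
Definition toeplitz_contraction (kappa : R) (c1 c2 c3 : C) : Prop :=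
  forall p0 p1 p2 : C,
    sqnorm3 (c1 * p0) (c2 * p0 + c1 * p1) (c3 * p0 + c2 * p1 + c1 * p2)%C
      <= kappa * sqnorm3 p0 p1 p2.

Lemma Re_mult_conj (z : C) : Re (z * Cconj z)%C = Cmod z ^ 2.
Proof. rewrite <- Cmod2_conj; reflexivity. Qed.

Lemma square_completion (P Q X : C) :
  Cmod X <= Cmod P -> 0 <= Re (P * Cconj P + Q * Cconj Q + - (2) * (X * Cconj Q))%C.
Proof.
  intros H.
  assert (H2 : Cmod X ^ 2 <= Cmod P ^ 2) by (apply pow_incr; split; [apply Cmod_ge_0 | auto]).
  rewrite !Cmod2_alt in H2.
  destruct P as [a b], Q as [c d], X as [e f]; simpl in *.
  assert (H3 := pow2_ge_0 (c - e)); assert (H4 := pow2_ge_0 (d - f)); simpl in *; lra.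
Qed.

(** Bessel's inequality.  Multiplication by [psi / z] does not increase the
    mean square of the polynomial [p], and [q] is the projection of the
    product on the polynomials of degree at most 2: expanding
    [|psi / z * p - q|^2 >= 0] leaves [|q|^2 <= |p|^2] in the mean. *)
Lemma toeplitz_of_bounded (psi : R -> C) (g1 g2 g3 : C) :
  (forall t, Cmod (psi t) <= 1) ->
  (forall m, (m <= 3)%Z ->
     circle_mean (fun t => psi t * character (- m) t)%C (cubic_coeff g1 g2 g3 m)) ->
  toeplitz_contraction 1 g1 g2 g3.
Proof.
  intros Hpsi Hmean p0 p1 p2.
  set (q0 := (g1 * p0)%C); set (q1 := (g2 * p0 + g1 * p1)%C).
  set (q2 := (g3 * p0 + g2 * p1 + g1 * p2)%C).
  set (F1 := fun m : Z => if Z.eqb m 0 then RtoC 1 else RtoC 0).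
  assert (Hone : forall m, (-2 <= m <= 2)%Z ->
     circle_mean (fun t => RtoC 1 * character (- m) t)%C (F1 m)).
  { intros m _; eapply circle_mean_ext; [| |apply (circle_mean_character (- m))].
    - intros t; simpl; ring.
    - unfold F1; destruct (Z.eqb_spec (- m) 0), (Z.eqb_spec m 0); auto; lia. }
  set (phi := fun t => (psi t * character (-1) t)%C).
  assert (Hphi : forall m, (-2 <= m <= 2)%Z ->
     circle_mean (fun t => phi t * character (- m) t)%C (cubic_coeff g1 g2 g3 (m + 1))).
  { intros m Hm; eapply circle_mean_ext; [|reflexivity|apply (Hmean (m + 1)%Z); lia].
    intros t; unfold phi; simpl.
    rewrite <- Cmult_assoc, character_add; do 2 f_equal; lia. }
  assert (HM := circle_mean_plus _ _ _ _ (circle_mean_plus _ _ _ _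
     (circle_mean_pairing _ _ p0 p1 p2 p0 p1 p2 Hone)
     (circle_mean_pairing _ _ q0 q1 q2 q0 q1 q2 Hone))
     (circle_mean_scal (- (2))%C _ _
        (circle_mean_pairing _ _ p0 p1 p2 q0 q1 q2 Hphi))).
  apply circle_mean_Re_nonneg in HM.
  - match type of HM with 0 <= Re ?x =>
      replace x with (p0 * Cconj p0 + p1 * Cconj p1 + p2 * Cconj p2
        + RtoC (-1) * (q0 * Cconj q0 + q1 * Cconj q1 + q2 * Cconj q2))%C in HM end.
    + rewrite <- !Cmod2_conj, <- !RtoC_plus, <- !RtoC_mult, <- !RtoC_plus in HM.
      simpl Re in HM; unfold sqnorm3; lra.
    + unfold F1, cubic_coeff, q0, q1, q2; simpl; ring.
  - intros t.
    replace (RtoC 1 * trig_poly p0 p1 p2 t)%C with (trig_poly p0 p1 p2 t) by ring.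
    replace (RtoC 1 * trig_poly q0 q1 q2 t)%C with (trig_poly q0 q1 q2 t) by ring.
    apply square_completion.
    unfold phi; rewrite !Cmod_mult.
    assert (Hc : Cmod (character (-1) t) = 1).
    { assert (E := Re_mult_conj (character (-1) t)).
      rewrite character_conj, character_add, character_0 in E; simpl in E.
      assert (H0 := Cmod_ge_0 (character (-1) t)); nra. }
    rewrite Hc, Rmult_1_r.
    rewrite <- (Rmult_1_l (Cmod (trig_poly p0 p1 p2 t))) at 2.
    apply Rmult_le_compat_r; [apply Cmod_ge_0 | auto].
Qed.

Lemma toeplitz_scal (rho : R) (c1 c2 c3 : C) :
  toeplitz_contraction 1 c1 c2 c3 ->
  toeplitz_contraction (rho ^ 2) (RtoC rho * c1) (RtoC rho * c2) (RtoC rho * c3).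
Proof.
  intros H p0 p1 p2; specialize (H p0 p1 p2).
  replace (RtoC rho * c1 * p0)%C with (RtoC rho * (c1 * p0))%C by ring.
  replace (RtoC rho * c2 * p0 + RtoC rho * c1 * p1)%C
    with (RtoC rho * (c2 * p0 + c1 * p1))%C by ring.
  replace (RtoC rho * c3 * p0 + RtoC rho * c2 * p1 + RtoC rho * c1 * p2)%C
    with (RtoC rho * (c3 * p0 + c2 * p1 + c1 * p2))%C by ring.
  unfold sqnorm3 in *; rewrite !(Cmod_mult (RtoC rho)), !Rpow_mult_distr, Cmod_R, pow2_abs.
  assert (Hr := pow2_ge_0 rho); nra.
Qed.

(** The classical inequalities for the first three coefficients of a Schwarz
    function.  Each one is the positivity of [|p|^2 - |T p|^2] at the vector
    [p] that minimises it, up to scaling; the strict bound [kappa < 1] keeps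
    the pivots [D] and [D^2 - |c2|^2] positive, so that no degenerate case
    arises. *)
Lemma schwarz_pick_coefficients (kappa : R) (c1 c2 c3 : C) :
  kappa < 1 -> toeplitz_contraction kappa c1 c2 c3 ->
  let D := 1 - Cmod c1 ^ 2 in
  0 < D /\ Cmod c2 < D /\
  Cmod (RtoC D * c3 + Cconj c1 * c2 ^ 2)%C <= D ^ 2 - Cmod c2 ^ 2.
Proof.
  intros Hk HT D.
  assert (HT1 : forall p0 p1 p2 : C,
    sqnorm3 (c1 * p0) (c2 * p0 + c1 * p1) (c3 * p0 + c2 * p1 + c1 * p2)%C
      <= sqnorm3 p0 p1 p2).
  { intros p0 p1 p2; eapply Rle_trans; [apply HT|].
    assert (0 <= sqnorm3 p0 p1 p2)
      by (unfold sqnorm3; pose proof (pow2_ge_0 (Cmod p0));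
          pose proof (pow2_ge_0 (Cmod p1)); pose proof (pow2_ge_0 (Cmod p2)); lra).
    nra. }
  assert (HD : 0 < D).
  { specialize (HT (RtoC 0) (RtoC 0) (RtoC 1)).
    replace (c1 * 0)%C with (RtoC 0) in HT by ring.
    replace (c2 * 0 + 0)%C with (RtoC 0) in HT by ring.
    replace (c3 * 0 + c2 * 0 + c1 * 1)%C with c1 in HT by ring.
    unfold sqnorm3 in HT; rewrite Cmod_0, Cmod_1 in HT; unfold D; lra. }
  assert (Hu : (c1 * Cconj c1)%C = RtoC (1 - D))
    by (rewrite <- Cmod2_conj; f_equal; unfold D; ring).
  assert (HE : 0 < D ^ 2 - Cmod c2 ^ 2).
  { specialize (HT (RtoC 0) (RtoC D) (Cconj c1 * c2)%C).
    replace (c1 * 0)%C with (RtoC 0) in HT by ring.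
    replace (c2 * 0 + c1 * RtoC D)%C with (c1 * RtoC D)%C in HT by ring.
    replace (c3 * 0 + c2 * RtoC D + c1 * (Cconj c1 * c2))%C with c2 in HT.
    2:{ transitivity (c2 * RtoC D + c1 * Cconj c1 * c2)%C; [|ring].
        rewrite Hu, RtoC_minus; ring. }
    unfold sqnorm3 in HT.
    rewrite Cmod_0, !Cmod_mult, Cmod_conj, Cmod_R, !Rpow_mult_distr, pow2_abs in HT.
    replace (Cmod c1 ^ 2) with (1 - D) in HT by (unfold D; ring).
    assert (H1 : D <= 1) by (unfold D; pose proof (pow2_ge_0 (Cmod c1)); lra).
    assert (H2 := pow2_ge_0 (Cmod c2)); set (v := Cmod c2 ^ 2) in *.
    assert (H3 : 0 < D ^ 2 + (1 - D) * v) by nra.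
    assert (H4 : 0 < D * (D ^ 2 - v)) by nra.
    nra. }
  split; [auto|split].
  - assert (H0 := Cmod_ge_0 c2); nra.
  - set (E := D ^ 2 - Cmod c2 ^ 2) in *.
    set (B := (RtoC D * c1 * Cconj c2 + c2 * Cconj c3)%C).
    (* Elimination of the last coordinate, whose minimiser is Cconj c1 * A. *)
    assert (Hstep : forall p0 p1 : C,
      Cmod (RtoC D * p0)%C ^ 2 + D * Cmod p1 ^ 2 - D * Cmod (c2 * p0 + c1 * p1)%C ^ 2
        - Cmod (c3 * p0 + c2 * p1)%C ^ 2 >= 0).
    { intros p0 p1.
      set (A := (c3 * p0 + c2 * p1)%C).
      specialize (HT1 (RtoC D * p0)%C (RtoC D * p1)%C (Cconj c1 * A)%C).
      replace (c1 * (RtoC D * p0))%C with (RtoC D * (c1 * p0))%C in HT1 by ring.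
      replace (c2 * (RtoC D * p0) + c1 * (RtoC D * p1))%C
        with (RtoC D * (c2 * p0 + c1 * p1))%C in HT1 by ring.
      replace (c3 * (RtoC D * p0) + c2 * (RtoC D * p1) + c1 * (Cconj c1 * A))%C
        with A in HT1.
      2:{ transitivity (RtoC D * A + c1 * Cconj c1 * A)%C; [|unfold A; ring].
          rewrite Hu, RtoC_minus; ring. }
      unfold sqnorm3 in HT1.
      rewrite !(Cmod_mult (RtoC D)), !Rpow_mult_distr, Cmod_R, pow2_abs in HT1.
      rewrite !(Cmod_mult (RtoC D)), !Rpow_mult_distr, Cmod_R, pow2_abs.
      rewrite (Cmod_mult (Cconj c1)), (Cmod_mult c1 p0), !Rpow_mult_distr, Cmod_conj in HT1.
      replace (Cmod c1 ^ 2) with (1 - D) in HT1 by (unfold D; ring).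
      apply Rle_ge, (Rmult_le_reg_l D); auto; nra. }
    (* In p1, with p0 = 1, the form is E |p1|^2 - 2 Re (p1 B) + constant. *)
    specialize (Hstep (RtoC E) (Cconj B)).
    assert (Hid : Cmod (RtoC D * RtoC E)%C ^ 2 + D * Cmod (Cconj B) ^ 2
        - D * Cmod (c2 * RtoC E + c1 * Cconj B)%C ^ 2
        - Cmod (c3 * RtoC E + c2 * Cconj B)%C ^ 2
        = E * (E ^ 2 - Cmod (RtoC D * c3 + Cconj c1 * c2 ^ 2)%C ^ 2)).
    { unfold B, E, D; rewrite !Cmod2_alt.
      destruct c1 as [a b], c2 as [c d], c3 as [e f]; simpl; ring. }
    rewrite Hid in Hstep.
    set (W := Cmod (RtoC D * c3 + Cconj c1 * c2 ^ 2)%C) in *.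
    assert (HW : 0 <= W) by apply Cmod_ge_0.
    assert (H2 : 0 <= E ^ 2 - W ^ 2) by nra.
    nra.
Qed.

(** * The bound for the Hankel determinant *)

(** With [c = |c1|], eliminating [c3] leaves an estimate whose coefficient of
    [|c2|^2] is [2 (1 - c) (2 - c) >= 0]; hence the extreme case is
    [|c2| = D = 1 - c^2], and there remains a quadratic polynomial in [c^2],
    which is bounded by completing the square. *)
Lemma hankel_schwarz_bound (s kappa : R) (c1 c2 c3 : C) :
  0 < s -> s <= 1 -> kappa < 1 -> toeplitz_contraction kappa c1 c2 c3 ->
  Cmod (hankel_schwarz s c1 c2 c3) <= 4 + 9 * s ^ 2 / (2 * (s ^ 2 + 3 * s + 6)).
Proof.
  intros Hs0 Hs1 Hk HT.
  destruct (schwarz_pick_coefficients kappa c1 c2 c3 Hk HT) as (HD & H2 & HW).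
  set (D := 1 - Cmod c1 ^ 2) in *.
  set (W := (RtoC D * c3 + Cconj c1 * c2 ^ 2)%C) in *.
  set (k := (2 + 3 * s - s ^ 2) / 2).
  assert (Hk0 : 0 <= k) by (unfold k; nra).
  assert (Hu : (c1 * Cconj c1)%C = RtoC (Cmod c1 ^ 2)) by (symmetry; apply Cmod2_conj).
  set (c := Cmod c1) in *; set (y := Cmod c2) in *.
  assert (Hc0 : 0 <= c) by apply Cmod_ge_0.
  assert (Hy0 : 0 <= y) by apply Cmod_ge_0.
  assert (Hid : (RtoC D * hankel_schwarz s c1 c2 c3)%C =
    (6 * c1 * W + - (RtoC (6 * c ^ 2 + 4 * D) * c2 ^ 2)
     + RtoC ((3 * s + 2) * D) * (c1 ^ 2 * c2) + RtoC (k * D) * c1 ^ 4)%C).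
  { unfold hankel_schwarz, W; fold k.
    rewrite (RtoC_plus (6 * c ^ 2)), (RtoC_mult 6), <- Hu,
      (RtoC_mult 4), (RtoC_mult (3 * s + 2)), (RtoC_mult k); ring. }
  assert (Hineq : D * Cmod (hankel_schwarz s c1 c2 c3) <=
    6 * c * (D ^ 2 - y ^ 2) + (6 * c ^ 2 + 4 * D) * y ^ 2
    + (3 * s + 2) * D * (c ^ 2 * y) + k * D * c ^ 4).
  { assert (E : Cmod (RtoC D * hankel_schwarz s c1 c2 c3)%C
                = D * Cmod (hankel_schwarz s c1 c2 c3))
      by (rewrite Cmod_mult, Cmod_R, Rabs_right by lra; reflexivity).
    rewrite <- E, Hid.
    assert (Hr : forall r z, 0 <= r -> Cmod (RtoC r * z)%C = r * Cmod z)
      by (intros r z Hr; rewrite Cmod_mult, Cmod_R, Rabs_right by lra; reflexivity).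
    repeat (eapply Rle_trans; [apply Cmod_triangle|]; apply Rplus_le_compat).
    - rewrite <- Cmult_assoc, Hr, Cmod_mult by lra; fold c.
      rewrite Rmult_assoc; apply Rmult_le_compat_l; [lra|].
      apply Rmult_le_compat_l; auto.
    - rewrite Cmod_opp, Hr, Cmod_pow by nra; fold y; lra.
    - rewrite Hr, Cmod_mult, Cmod_pow by nra; fold c y; lra.
    - rewrite Hr, Cmod_pow by nra; fold c; lra. }
  assert (Hc1 : c < 1) by (unfold D in HD; nra).
  assert (Hy2 : y ^ 2 <= D ^ 2) by (apply pow_incr; lra).
  assert (Hcoef : 0 <= (6 * c ^ 2 + 4 * D) - 6 * c)
    by (unfold D; replace (6 * c ^ 2 + 4 * (1 - c ^ 2) - 6 * c)
          with (2 * ((1 - c) * (2 - c))) by ring; nra).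
  assert (Hsq : 6 * c * (D ^ 2 - y ^ 2) + (6 * c ^ 2 + 4 * D) * y ^ 2
                <= (6 * c ^ 2 + 4 * D) * D ^ 2) by nra.
  assert (Hlin : (3 * s + 2) * D * (c ^ 2 * y) <= (3 * s + 2) * D * (c ^ 2 * D)).
  { apply Rmult_le_compat_l; [nra|]; apply Rmult_le_compat_l; [apply pow2_ge_0 | lra]. }
  assert (Hb : Cmod (hankel_schwarz s c1 c2 c3) <=
    (6 * c ^ 2 + 4 * D) * D + (3 * s + 2) * (c ^ 2 * D) + k * c ^ 4)
    by (apply (Rmult_le_reg_l D); auto; lra).
  eapply Rle_trans; [exact Hb|].
  replace ((6 * c ^ 2 + 4 * D) * D + (3 * s + 2) * (c ^ 2 * D) + k * c ^ 4)
    with (4 + 3 * s * c ^ 2 - (s ^ 2 + 3 * s + 6) / 2 * (c ^ 2) ^ 2)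
    by (unfold D, k; field).
  set (q := s ^ 2 + 3 * s + 6).
  assert (Hq : 0 < q) by (unfold q; nra).
  assert (Hsquare : 0 <= / (2 * q) * (q * c ^ 2 - 3 * s) ^ 2).
  { apply Rmult_le_pos; [left; apply Rinv_0_lt_compat; lra | apply pow2_ge_0]. }
  replace (4 + 9 * s ^ 2 / (2 * q)) with
    (4 + 3 * s * c ^ 2 - q / 2 * (c ^ 2) ^ 2 + / (2 * q) * (q * c ^ 2 - 3 * s) ^ 2)
    by (field; lra).
  lra.
Qed.

Lemma continuous_bound_at_1 (g : R -> R) (M : R) :
  continuity_pt g 1 -> (forall r, 0 < r -> r < 1 -> g r <= M) -> g 1 <= M.
Proof.
  intros Hg H; apply Rnot_lt_le; intros Hlt.
  destruct (Hg (g 1 - M) ltac:(lra)) as (d & Hd & Hc).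
  set (r := 1 - Rmin d 1 / 2).
  assert (H1 := Rmin_l d 1); assert (H2 := Rmin_r d 1).
  assert (H3 : 0 < Rmin d 1) by (apply Rmin_glb_lt; lra).
  specialize (H r ltac:(unfold r; lra) ltac:(unfold r; lra)).
  specialize (Hc r); unfold dist in Hc; simpl in Hc; unfold Rdist in Hc.
  assert (Hlt' : Rabs (g r - g 1) < g 1 - M).
  { apply Hc; split; [split; [exact I | unfold r; lra]|].
    unfold r; apply Rabs_lt_between; lra. }
  apply Rabs_lt_between in Hlt'; lra.
Qed.

(** The circle of radius [r] turns the coefficient [c_k] into [r^k c_k]. *)
Lemma toeplitz_of_schwarz (omega : C -> C) (c1 c2 c3 : C) (r : R) :
  holomorphic_on_disk omega ->
  (forall z, in_disk z -> in_disk (omega z)) ->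
  bigO 4 (fun z => omega z - cubic c1 c2 c3 z)%C ->
  0 < r -> r < 1 ->
  toeplitz_contraction 1 (RtoC r * c1) (RtoC (r ^ 2) * c2) (RtoC (r ^ 3) * c3).
Proof.
  intros Hol Hdisk Hbig Hr0 Hr1.
  set (a := ln r).
  assert (Ha : a < 0) by (unfold a; rewrite <- ln_1; apply ln_increasing; auto).
  assert (Hexp : exp a = r) by (apply exp_ln; auto).
  apply (toeplitz_of_bounded (fun t => omega (Cexp (a, t)))).
  - intros t; left; apply Hdisk, in_disk_Cexp; exact Ha.
  - intros m Hm.
    eapply circle_mean_ext; [| |apply (circle_mean_coeff omega c1 c2 c3 m a); auto].
    + intros t; reflexivity.
    + unfold cubic_coeff.
      destruct (Z.eqb_spec m 1) as [->|_]; [rewrite Rmult_1_l, Hexp; auto|].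
      destruct (Z.eqb_spec m 2) as [->|_].
      { replace (2 * a) with (a + a) by ring; rewrite exp_plus, Hexp.
        do 2 f_equal; ring. }
      destruct (Z.eqb_spec m 3) as [->|_]; [|ring].
      replace (3 * a) with (a + (a + a)) by ring; rewrite !exp_plus, Hexp.
      do 2 f_equal; ring.
Qed.

(** The coefficients are multiplied by one more factor [r] than the circle of
    radius [r] produces, to have a strict contraction; then [r] tends to 1. *)
Lemma schwarz_hankel_bound (s : R) (omega : C -> C) (c1 c2 c3 : C) :
  0 < s -> s <= 1 ->
  holomorphic_on_disk omega ->
  (forall z, in_disk z -> in_disk (omega z)) ->
  bigO 4 (fun z => omega z - cubic c1 c2 c3 z)%C ->
  Cmod (hankel_schwarz s c1 c2 c3) <= 4 + 9 * s ^ 2 / (2 * (s ^ 2 + 3 * s + 6)).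
Proof.
  intros Hs0 Hs1 Hol Hdisk Hbig.
  set (M := 4 + 9 * s ^ 2 / (2 * (s ^ 2 + 3 * s + 6))).
  assert (HM : 0 <= M).
  { unfold M; assert (0 <= 9 * s ^ 2 / (2 * (s ^ 2 + 3 * s + 6)))
      by (apply Rdiv_le_0_compat; nra). lra. }
  set (S := fun r : R => hankel_schwarz s (RtoC (r ^ 2) * c1)
               (RtoC (r ^ 3) * c2) (RtoC (r ^ 4) * c3)).
  assert (Hr : forall r, 0 < r -> r < 1 -> Cmod (S r) ^ 2 <= M ^ 2).
  { intros r Hr0 Hr1; apply pow_incr; split; [apply Cmod_ge_0|].
    unfold S, M; apply (hankel_schwarz_bound s (r ^ 2)); auto; [nra|].
    assert (HT := toeplitz_scal r _ _ _
      (toeplitz_of_schwarz omega c1 c2 c3 r Hol Hdisk Hbig Hr0 Hr1)).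
    replace (RtoC (r ^ 2) * c1)%C with (RtoC r * (RtoC r * c1))%C
      by (rewrite Cmult_assoc, <- RtoC_mult; do 2 f_equal; ring).
    replace (RtoC (r ^ 3) * c2)%C with (RtoC r * (RtoC (r ^ 2) * c2))%C
      by (rewrite Cmult_assoc, <- RtoC_mult; do 2 f_equal; ring).
    replace (RtoC (r ^ 4) * c3)%C with (RtoC r * (RtoC (r ^ 3) * c3))%C
      by (rewrite Cmult_assoc, <- RtoC_mult; do 2 f_equal; ring).
    exact HT. }
  assert (H1 : S 1 = hankel_schwarz s c1 c2 c3)
    by (unfold S; rewrite !pow1, !Cmult_1_l; reflexivity).
  rewrite <- H1.
  assert (Hsq : Cmod (S 1) ^ 2 <= M ^ 2).
  { apply (continuous_bound_at_1 (fun r => Cmod (S r) ^ 2)); auto.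
    set (A := (6 * c1 * c3 - 4 * c2 ^ 2)%C).
    set (B := (RtoC (3 * s + 2) * c1 ^ 2 * c2)%C).
    set (E := (RtoC ((2 + 3 * s - s ^ 2) / 2) * c1 ^ 4)%C).
    apply (continuity_pt_ext (fun r =>
      (r ^ 6 * Re A + r ^ 7 * Re B + r ^ 8 * Re E) ^ 2
      + (r ^ 6 * Im A + r ^ 7 * Im B + r ^ 8 * Im E) ^ 2)); [|reg].
    intros r; rewrite Cmod2_alt.
    replace (S r) with (RtoC (r ^ 6) * A + RtoC (r ^ 7) * B + RtoC (r ^ 8) * E)%C.
    - destruct A, B, E; simpl; ring.
    - unfold S, hankel_schwarz, A, B, E; rewrite !RtoC_pow; ring. }
  apply Rnot_lt_le; intros Hlt; nra.
Qed.

Theorem theorem3p5 (s : R) (hs0 : 0 < s) (hs1 : s <= 1)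
    (h : C -> C) (hh : CV_hpl s h)
    (d : nat -> C) (hd : normalized_expansion h d) :
  Cmod (hankel_2_2 d)
    <= s ^ 2 / 36 * (1 + 9 * s ^ 2 / (8 * (s ^ 2 + 3 * s + 6))).
Proof.
  destruct hh as [_ (omega & Hol & Hdisk & H0 & Hq)].
  assert (Hzero : in_disk (RtoC 0)) by (unfold in_disk; rewrite Cmod_0; lra).
  destruct (schwarz_coefficients s h omega d hs0 hd (Hol _ Hzero) H0 Hdisk Hq)
    as (c1 & c2 & c3 & Hbig & ->).
  rewrite Cmod_mult, Cmod_R, Rabs_right by nra.
  apply Rle_trans with (s ^ 2 / 144 * (4 + 9 * s ^ 2 / (2 * (s ^ 2 + 3 * s + 6)))).
  - apply Rmult_le_compat_l; [nra|].
    apply (schwarz_hankel_bound s omega); auto.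
  - right; field; nra.
Qed.
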